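(* For every integer $n\ge 0$, \[B_{3}(n)=\sum_{\substack{d\mid n+1\\ d\equiv 1 \ (\mathrm{mod}\ 3)}}\Big(\frac{n+1}{d}\Big)^2-\sum_{\substack{d\mid n+1\\ d\equiv 2\ (\mathrm{mod}\ 3)}}\Big(\frac{n+1}{d}\Big)^2,\] where $d$ runs over positive divisors. Furthermore, if \[n+1=3^{\alpha}\prod_{p_i \equiv 1 \ (\mathrm{mod}\ 3)}p_{i}^{\alpha_i}\prod_{q_{j} \equiv 2 \ (\mathrm{mod}\ 3)}q_{j}^{\beta_j}\] is the prime factorization of $n+1$ (with $\alpha,\alpha_i,\beta_j\ge 0$, $p_i,q_j$ primes), then \[B_{3}(n)=3^{2\alpha}\prod_{p_i \equiv 1 \ (\mathrm{mod}\ 3)}\frac{p_{i}^{2(\alpha_i+1)}-1}{p_{i}^2-1}\prod_{q_{j} \equiv 2 \ (\mathrm{mod}\ 3)}\frac{q_{j}^{2\beta_j+2}+(-1)^{\beta_j}}{q_{j}^2+1}.\]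
   Context: A partition $\lambda$ of a nonnegative integer is called a $3$-core if none of its hook lengths is divisible by $3$. $B_3(n)$ denotes the number of partition triples of $n$ with $3$-cores, i.e. the number of ordered triples $(\lambda_1,\lambda_2,\lambda_3)$ of partitions, each a $3$-core, whose sizes sum to $n$; equivalently $\sum_{n\ge0}B_3(n)q^n=\frac{(q^3;q^3)_\infty^{9}}{(q;q)_\infty^{3}}$, where $(a;q)_\infty=\prod_{k\ge0}(1-aq^k)$. *)

(* Defs.v *)
From mathcomp Require Import all_boot all_order all_algebra.
Set Implicit Arguments. Unset Strict Implicit. Unset Printing Implicit Defensive.

Definition is_partition (s : seq nat) : bool :=
  sorted geq s && all (fun x => 0 < x) s.

Definition psize (s : seq nat) : nat := sumn s.

Definition conj_part (s : seq nat) (j : nat) : nat := count (fun x => j < x) s.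

(* hook length of the cell (i, j) (0-indexed row i, column j):
   arm + leg + 1 = (lambda_i - j - 1) + (lambda'_j - i - 1) + 1 *)
Definition hook (s : seq nat) (i j : nat) : nat :=
  (nth 0 s i - j.+1) + (conj_part s j - i.+1) + 1.

Definition is_core (t : nat) (s : seq nat) : bool :=
  all (fun i => all (fun j => ~~ (t %| hook s i j)) (iota 0 (nth 0 s i)))
      (iota 0 (size s)).

Fixpoint seqs_len (k : nat) (A : seq nat) : seq (seq nat) :=
  if k is k'.+1 then [seq a :: s | a <- A, s <- seqs_len k' A] else [:: [::]].

(* all sequences of length <= n with entries in {1,...,n}; every partition
   of size <= n occurs exactly once among them *)
Definition cands (n : nat) : seq (seq nat) :=
  flatten [seq seqs_len k (iota 1 n) | k <- iota 0 n.+1].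

Definition cores3_upto (n : nat) : seq (seq nat) :=
  [seq s <- cands n | is_partition s && is_core 3 s].

Definition B3 (n : nat) : nat :=
  count (fun t : seq nat * seq nat * seq nat =>
           psize t.1.1 + psize t.1.2 + psize t.2 == n)
        (flatten [seq [seq (ab, c) | c <- cores3_upto n]
                 | ab <- [seq (a, b) | a <- cores3_upto n, b <- cores3_upto n]]).

(* Main.v *)
(** A 3-core is determined by how its first-column hook lengths split into
    [{1, 4, ..}] and [{2, 5, ..}], so 3-cores are indexed by pairs (u, v) of naturals,
    with size u^2 - uv + v^2 + v. These pairs index a 120 degree sector of the Eisenstein integers
    of norm 3k + 1 that are 1 modulo the prime above 3, hence there are
    E(3k + 1) 3-cores of size k, with E(N) = sum of chi(d) over d | N and chi the
    character modulo 3.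

    The threefold convolution of E is then evaluated by Liouville's method: on the set
    of positive solutions of ax + by = N, the map (a, b, x, y) -> (a - b, b, x, x + y)
    is a bijection from {a > b} to {x < y}. It gives first
    3 sum E(k) E(N - k) = sigma(N) for N = 2 mod 3, then
    sum E(k) sigma(3m - k) = 3 sum chi(d) (m/d)^2 over k prime to 3.
    The product formula follows by multiplicativity. *)
Require Import Defs.
From mathcomp Require Import all_boot all_order all_algebra all_fingroup all_field.
From mathcomp Require Import zify ring.
Import GRing.Theory Num.Theory.
Local Open Scope ring_scope.

(** The residues modulo 3 make the two convolutions fit together. E vanishes at arguments 2 mod 3,
    by pairing d with N / d. The cores supply only the values E(3i + 1), and the three arguments add
    up to 3(n + 1). Once one of them is fixed, the other two have a sum that is 2 mod 3; in the full
    convolution with that sum, every term whose arguments are not both 1 mod 3 has a factor E at a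
    number 2 mod 3. So the inner sum may run over all k. In the outer sum multiples of 3 are paired
    with multiples of 3, and they have to be removed by the weight chi(d)^2.

    The map of Liouville's method keeps the equation because (a - b) x + b (x + y) = a x + b y. It
    exchanges congruence conditions modulo 3, so that the parts off the diagonals a = b and x = y
    cancel, and what remains on the diagonals is a divisor sum.

    For the norm count, the number of elements of norm p^k m that are 1 modulo 1 - w obeys, in k,
    the same two-term recursion as the geometric sums of chi(p). The factor 3 in front of E comes
    from the units 1, w, w^2. *)

Lemma big_seq_bij (V : nmodType) (I J : eqType) (s : seq I) (t : seq J)
    (P : pred I) (Q : pred J) (h : I -> J) (F : J -> V) :
  uniq s -> uniq t ->
  (forall i, i \in s -> P i -> (h i \in t) && Q (h i)) ->
  (forall i i', i \in s -> i' \in s -> P i -> P i' -> h i = h i' -> i = i') ->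
  (forall j, j \in t -> Q j -> exists2 i, (i \in s) && P i & h i = j) ->
  \sum_(j <- t | Q j) F j = \sum_(i <- s | P i) F (h i).
Proof.
move=> us ut st hinj hsurj.
rewrite -[LHS]big_filter -[RHS]big_filter -(big_map h xpredT F).
apply: perm_big; apply: uniq_perm.
- exact: filter_uniq.
- rewrite map_inj_in_uniq ?filter_uniq // => i i'.
  by rewrite !mem_filter => /andP[Pi si] /andP[Pi' si']; apply: hinj.
- move=> j; rewrite mem_filter; apply/idP/mapP => [/andP[Qj tj]|[i]].
    have [i /andP[si Pi] <-] := hsurj j tj Qj.
    by exists i => //; rewrite mem_filter Pi.
  rewrite mem_filter => /andP[Pi si] ->.
  by rewrite andbC; apply: st.
Qed.

(** * Positive solutions of [a x + b y = N] *)

Definition chi (n : nat) : int := (n %% 3 == 1)%N%:R - (n %% 3 == 2)%N%:R.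

Lemma mod3P (n : nat) : [\/ n %% 3 = 0, n %% 3 = 1 | n %% 3 = 2]%N.
Proof. by case: (n %% 3)%N (ltn_pmod n (isT : 0 < 3)%N) => [|[|[|]]] // _; constructor. Qed.

Lemma chiM m n : chi (m * n) = chi m * chi n.
Proof.
rewrite /chi -modnMm.
by case: (mod3P m) => ->; case: (mod3P n) => ->.
Qed.

Lemma chi_sq n : chi n ^+ 2 = (~~ (3 %| n)%N)%:R.
Proof. by rewrite /chi /dvdn; case: (mod3P n) => ->. Qed.

Definition chi_sum (n : nat) : int := \sum_(d <- divisors n) chi d.
Definition sigma (n : nat) : int := \sum_(d <- divisors n) d%:Z.
Definition chi_sq_sum (n : nat) : int :=
  \sum_(d <- divisors n) chi d * (n %/ d)%:Z ^+ 2.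

Definition quads (N : nat) : seq ((nat * nat) * (nat * nat)) :=
  [seq q <- [seq (ab, xy) | ab <- [seq (a, b) | a <- iota 1 N, b <- iota 1 N],
                            xy <- [seq (x, y) | x <- iota 1 N, y <- iota 1 N]]
   | q.1.1 * q.2.1 + q.1.2 * q.2.2 == N]%N.

Lemma uniq_quads N : uniq (quads N).
Proof.
apply: filter_uniq; apply: allpairs_uniq; last by move=> [? ?] [? ?] _ _ [-> ->].
- by apply: allpairs_uniq; rewrite ?iota_uniq // => -[? ?] [? ?] _ _ [-> ->].
- by apply: allpairs_uniq; rewrite ?iota_uniq // => -[? ?] [? ?] _ _ [-> ->].
Qed.

Lemma mem_quads N a b x y :
  ((a, b), (x, y)) \in quads N =
  [&& 0 < a, 0 < b, 0 < x, 0 < y & a * x + b * y == N]%N.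
Proof.
rewrite mem_filter /= andbC; apply/idP/idP.
  case/andP=> /allpairsP[[[a1 b1] [x1 y1]] /= [+ + [-> -> -> ->]]].
  case/allpairsP=> -[? ?] /= [+ + [-> ->]]; rewrite !mem_iota => ? ?.
  case/allpairsP=> -[? ?] /= [+ + [-> ->]]; rewrite !mem_iota => ? ? ?.
  by apply/and5P; split; lia.
case/and5P=> a0 b0 x0 y0 /[dup] /eqP e ->; rewrite andbT.
apply/allpairsP; exists ((a, b), (x, y)); split => //.
  by apply/allpairsP; exists (a, b); rewrite !mem_iota; split => //=; nia.
by apply/allpairsP; exists (x, y); rewrite !mem_iota; split => //=; nia.
Qed.

Definition qsum (N : nat) (P : nat -> nat -> nat -> nat -> bool)
    (f : nat -> nat -> nat -> nat -> int) : int :=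
  \sum_(q <- quads N | P q.1.1 q.1.2 q.2.1 q.2.2) f q.1.1 q.1.2 q.2.1 q.2.2.

Lemma eq_qsum N (P Q : nat -> nat -> nat -> nat -> bool) f g :
  (forall a b x y, (0 < a -> 0 < b -> 0 < x -> 0 < y -> a * x + b * y = N ->
     P a b x y = Q a b x y /\ (P a b x y -> f a b x y = g a b x y)))%N ->
  qsum N P f = qsum N Q g.
Proof.
move=> H; rewrite /qsum big_seq_cond [RHS]big_seq_cond.
have H' q : q \in quads N ->
    P q.1.1 q.1.2 q.2.1 q.2.2 = Q q.1.1 q.1.2 q.2.1 q.2.2 /\
    (P q.1.1 q.1.2 q.2.1 q.2.2 ->
     f q.1.1 q.1.2 q.2.1 q.2.2 = g q.1.1 q.1.2 q.2.1 q.2.2).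
  case: q => [[a b] [x y]]; rewrite mem_quads => /and5P[a0 b0 x0 y0 /eqP e].
  exact: H.
apply: eq_big => [q|q /andP[/H'[_ H1] /H1 //]].
by case: (boolP (q \in quads N)) => //= /H'[-> _].
Qed.

Lemma qsum_split N (c P : nat -> nat -> nat -> nat -> bool) f :
  qsum N P f = qsum N (fun a b x y => c a b x y && P a b x y) f +
               qsum N (fun a b x y => ~~ c a b x y && P a b x y) f.
Proof.
rewrite /qsum (bigID (fun q => c q.1.1 q.1.2 q.2.1 q.2.2)) /=.
by congr (_ + _); apply: eq_bigl => q; rewrite andbC.
Qed.

Lemma qsum_bij N (P Q : nat -> nat -> nat -> nat -> bool) (f g : nat -> nat -> nat -> nat -> int)
    (h k : nat * nat * (nat * nat) -> nat * nat * (nat * nat)) :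
  (forall q, q \in quads N -> P q.1.1 q.1.2 q.2.1 q.2.2 ->
     [/\ h q \in quads N, Q (h q).1.1 (h q).1.2 (h q).2.1 (h q).2.2,
         k (h q) = q & f q.1.1 q.1.2 q.2.1 q.2.2 = g (h q).1.1 (h q).1.2 (h q).2.1 (h q).2.2]) ->
  (forall q, q \in quads N -> Q q.1.1 q.1.2 q.2.1 q.2.2 ->
     [/\ k q \in quads N, P (k q).1.1 (k q).1.2 (k q).2.1 (k q).2.2 & h (k q) = q]) ->
  qsum N P f = qsum N Q g.
Proof.
move=> H K; rewrite /qsum [LHS]big_seq_cond.
rewrite [RHS](@big_seq_bij _ _ _ (quads N) (quads N)
   (fun q => P q.1.1 q.1.2 q.2.1 q.2.2) _ h) ?uniq_quads //.
- by rewrite [RHS]big_seq_cond; apply: eq_bigr => q /andP[qN Pq]; have [] := H q qN Pq.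
- by move=> q qN Pq; have [-> ->] := H q qN Pq.
- move=> q q' qN qN' Pq Pq' e.
  by have [_ _ <- _] := H q qN Pq; have [_ _ <- _] := H q' qN' Pq'; rewrite e.
- by move=> q qN Qq; have [? ? <-] := K q qN Qq; exists (k q) => //; apply/andP.
Qed.

Lemma qsum_swap N P f :
  qsum N P f = qsum N (fun a b x y => P b a y x) (fun a b x y => f b a y x).
Proof.
pose h (q : nat * nat * (nat * nat)) := ((q.1.2, q.1.1), (q.2.2, q.2.1)).
apply: (@qsum_bij N _ _ _ _ h h) => -[[a b] [x y]]; rewrite !mem_quads /= => + ?.
  by case/and5P=> -> -> -> ->; rewrite addnC; split.
by case/and5P=> -> -> -> ->; rewrite addnC; split.
Qed.

(** Liouville's substitution, based on a x + b y = (a - b) x + b (x + y). The right side is written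
    in the new coordinates, so [P] and [f] are taken at the preimage. *)
Lemma qsum_shift N P f :
  qsum N (fun a b x y => (b < a)%N && P a b x y) f =
  qsum N (fun a b x y => (x < y)%N && P (a + b)%N b x (y - x)%N)
         (fun a b x y => f (a + b)%N b x (y - x)%N).
Proof.
pose h (q : nat * nat * (nat * nat)) := ((q.1.1 - q.1.2, q.1.2), (q.2.1, q.2.1 + q.2.2))%N.
pose k (q : nat * nat * (nat * nat)) := ((q.1.1 + q.1.2, q.1.2), (q.2.1, q.2.2 - q.2.1))%N.
apply: (@qsum_bij N _ _ _ _ h k) => -[[a b] [x y]]; rewrite !mem_quads /=.
  case/and5P=> a0 b0 x0 y0 /eqP e /andP[ba Pq].
  have e1 : (a - b + b = a)%N by lia.
  have e2 : (x + y - x = y)%N by lia.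
  split; rewrite /h /k /= ?e1 ?e2 //.
    by apply/and5P; split; [lia | lia | lia | lia | apply/eqP; nia].
  by rewrite Pq andbT; lia.
case/and5P=> a0 b0 x0 y0 /eqP e /andP[ba Pq]; split.
- by apply/and5P; split; [lia | lia | lia | lia | apply/eqP; nia].
- by rewrite Pq andbT; lia.
- by rewrite /h /k /=; congr ((_, _), (_, _)); lia.
Qed.

(** The same substitution conjugated by the swap: a x + b y = a (x + y) + (b - a) y. *)
Lemma qsum_shift2 N P f :
  qsum N (fun a b x y => (a < b)%N && P a b x y) f =
  qsum N (fun a b x y => (y < x)%N && P a (b + a)%N (x - y)%N y)
         (fun a b x y => f a (b + a)%N (x - y)%N y).
Proof. by rewrite qsum_swap (qsum_shift N (fun a b x y => P b a y x)) [RHS]qsum_swap. Qed.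

(** Setting k = a x identifies a solution with a number k, a divisor a of k and a divisor b of N -
    k. *)
Lemma qsum_conv N f g :
  \sum_(1 <= k < N) (\sum_(d <- divisors k) f d (k %/ d)%N) *
                    (\sum_(d <- divisors (N - k)) g d ((N - k) %/ d)%N) =
  qsum N (fun _ _ _ _ => true) (fun a b x y => f a x * g b y).
Proof.
pose t := [seq (k, de) | k <- index_iota 1 N,
           de <- [seq (d, e) | d <- divisors k, e <- divisors (N - k)%N]].
transitivity (\sum_(z <- t) f z.2.1 (z.1 %/ z.2.1)%N * g z.2.2 ((N - z.1) %/ z.2.2)%N).
  rewrite big_allpairs_dep; apply: eq_bigr => k _.
  by rewrite big_allpairs_dep /= big_distrlr.
rewrite /qsum [LHS](@big_seq_bij _ _ _ (quads N) t predT _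
  (fun q => (q.1.1 * q.2.1, (q.1.1, q.1.2)))%N); first 1 last.
- exact: uniq_quads.
- apply: allpairs_uniq_dep; first exact: iota_uniq.
    by move=> k _; apply: allpairs_uniq; rewrite ?divisors_uniq // => -[? ?] [? ?] _ _ [-> ->].
  by move=> [? ?] [? ?] _ _ /= [-> ->].
- move=> [[a b] [x y]]; rewrite mem_quads => /and5P[a0 b0 x0 y0 /eqP e] _.
  rewrite andbT /=; apply/allpairsPdep; exists (a * x)%N, (a, b); split => //.
    by rewrite mem_index_iota; nia.
  apply/allpairsPdep; exists a, b; split => //;
    first by rewrite -dvdn_divisors ?muln_gt0 ?a0 ?dvdn_mulr.
  have -> : (N - a * x = b * y)%N by lia.
  by rewrite -dvdn_divisors ?muln_gt0 ?b0 ?dvdn_mulr.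
- move=> [[a b] [x y]] [[a' b'] [x' y']]; rewrite !mem_quads.
  move=> /and5P[a0 b0 x0 y0 /eqP e] /and5P[_ _ _ _ /eqP e'] _ _ /= [ax ea eb].
  subst a' b'; have ex : x = x' by apply/eqP; rewrite -(eqn_pmul2l a0); apply/eqP.
  have ey : y = y' by apply/eqP; rewrite -(eqn_pmul2l b0); apply/eqP; lia.
  by rewrite ex ey.
- move=> [k [d e]] /allpairsPdep[k' [_ [kN /allpairsPdep[d' [e' [dk ek ->]]] [-> -> ->]]]] _.
  move: kN; rewrite mem_index_iota => /andP[k0 kN].
  move: dk ek; rewrite -!dvdn_divisors ?subn_gt0 // => /dvdnP[x kE] /dvdnP[y yE].
  exists ((d', e'), (x, y)); last by rewrite /= mulnC -kE.
  by rewrite mem_quads andbT; apply/and5P; split; [lia|lia|lia|lia|apply/eqP; lia].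
rewrite big_seq_cond [RHS]big_seq_cond; apply: eq_bigr => -[[a b] [x y]] /=.
rewrite andbT mem_quads => /and5P[a0 b0 x0 y0 /eqP e].
have -> : (N - a * x = b * y)%N by lia.
by rewrite !mulKn.
Qed.

Lemma qsum_inv N P f :
  qsum N P f = qsum N (fun a b x y => P x y a b) (fun a b x y => f x y a b).
Proof.
pose h (q : nat * nat * (nat * nat)) := (q.2, q.1).
apply: (@qsum_bij N _ _ _ _ h h) => -[[a b] [x y]]; rewrite !mem_quads /= => + ?.
  by case/and5P=> -> -> -> ->; rewrite !(mulnC x, mulnC y); split.
by case/and5P=> -> -> -> ->; rewrite !(mulnC x, mulnC y); split.
Qed.

(** For x = y = d the equation becomes (a + b) d = N, so d divides N and b = N / d - a. *)
Lemma qsum_diag N P f :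
  qsum N (fun a b x y => (x == y) && P a b x y) f =
  \sum_(d <- divisors N) \sum_(1 <= a < N %/ d | P a (N %/ d - a)%N d d)
     f a (N %/ d - a)%N d d.
Proof.
pose t := [seq (d, a) | d <- divisors N, a <- index_iota 1 (N %/ d)].
transitivity (\sum_(z <- t | P z.2 (N %/ z.1 - z.2)%N z.1 z.1)
    f z.2 (N %/ z.1 - z.2)%N z.1 z.1); last first.
  rewrite big_mkcond big_allpairs_dep; apply: eq_bigr => d _ /=.
  by rewrite [RHS]big_mkcond.
rewrite /qsum [RHS](@big_seq_bij _ _ _ (quads N) t
  (fun q => (q.2.1 == q.2.2) && P q.1.1 q.1.2 q.2.1 q.2.2) _
  (fun q => (q.2.1, q.1.1))).
- rewrite big_seq_cond [RHS]big_seq_cond; apply: eq_bigr => -[[a b] [x y]] /=.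
  rewrite mem_quads => /and3P[/and5P[a0 b0 x0 y0 /eqP e] /eqP xy _]; subst y.
  have -> : (N %/ x = a + b)%N by rewrite -e -mulnDl mulnK.
  by rewrite addKn.
- exact: uniq_quads.
- apply: allpairs_uniq_dep; rewrite ?divisors_uniq //; last by move=> [? ?] [? ?] _ _ /= [-> ->].
  by move=> *; apply: iota_uniq.
- move=> [[a b] [x y]] /=; rewrite mem_quads => /and5P[a0 b0 x0 y0 /eqP e] /andP[/eqP xy].
  subst y; have eN : (N %/ x = a + b)%N by rewrite -e -mulnDl mulnK.
  rewrite eN addKn => ->; rewrite andbT.
  apply/allpairsPdep; exists x, a; split => //; last by rewrite eN mem_index_iota; lia.
  by rewrite -e -mulnDl -dvdn_divisors ?dvdn_mull ?muln_gt0 ?addn_gt0 ?a0 ?x0.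
- move=> [[a b] [x y]] [[a' b'] [x' y']] /=; rewrite !mem_quads.
  move=> /and5P[a0 b0 x0 y0 /eqP e] /and5P[_ _ _ _ /eqP e'].
  move=> /andP[/eqP ? _] /andP[/eqP ? _] [? ?]; subst y y' x' a'.
  by have -> : b = b' by apply/eqP; rewrite -(eqn_pmul2r x0); apply/eqP; lia.
- move=> [d a] /= /allpairsPdep[d' [a' [dN]]]; rewrite mem_index_iota => aN [? ?] Pd.
  subst d' a'.
  have N0 : (0 < N)%N by case: N dN aN {t Pd} => // ; rewrite div0n; lia.
  move: dN; rewrite -dvdn_divisors // => dN.
  have d0 : (0 < d)%N by exact: dvdn_gt0 dN.
  exists ((a, (N %/ d - a)%N), (d, d)) => //=; rewrite eqxx Pd mem_quads andbT.
  rewrite -mulnDl subnKC ?divnK //; last by lia.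
  by rewrite eqxx d0 subn_gt0; case/andP: aN => -> ->.
Qed.

Lemma sum_divisors_rev N (F : nat -> int) : (0 < N)%N ->
  \sum_(d <- divisors N) F d = \sum_(d <- divisors N) F (N %/ d)%N.
Proof.
move=> N0.
rewrite (@big_seq_bij _ _ _ (divisors N) (divisors N) predT _
  (fun d => (N %/ d)%N)) ?divisors_uniq //.
- by move=> d; rewrite andbT -!dvdn_divisors // => dN _; apply: dvdn_div.
- move=> d e; rewrite -!dvdn_divisors // => dN eN _ _ E.
  by rewrite -(mulKn d N0) -(mulKn e N0) -!divnA // E.
- move=> d; rewrite -dvdn_divisors // => dN _; exists (N %/ d)%N.
    by rewrite andbT -dvdn_divisors // dvdn_div.
  by rewrite divnA // mulKn.
Qed.

Lemma chi_eq m n : (m %% 3 = n %% 3)%N -> chi m = chi n.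
Proof. by rewrite /chi => ->. Qed.

Lemma chi_opp m n : (3 %| m + n)%N -> chi m = - chi n.
Proof.
rewrite /chi /dvdn -modnDm.
by case: (mod3P m) => ->; case: (mod3P n) => ->.
Qed.

(** The divisors d and N / d have product 2 mod 3, so one is 1 and the other 2 mod 3, and their
    characters cancel. *)
Lemma chi_sum_2 N : (N %% 3 = 2)%N -> chi_sum N = 0.
Proof.
move=> N2; have N0 : (0 < N)%N by case: N N2.
suff : chi_sum N = - chi_sum N by lia.
rewrite {1}/chi_sum sum_divisors_rev // /chi_sum -sumrN big_seq [RHS]big_seq.
apply: eq_bigr => d; rewrite -dvdn_divisors // => dN.
apply: chi_opp; move: N2; rewrite -{1}(divnK dN) -modnMm /dvdn -modnDm.
by case: (mod3P (N %/ d)) => ->; case: (mod3P d) => ->.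
Qed.

Lemma sum_range_count (P : pred nat) n :
  \sum_(1 <= a < n | P a) 1 = (count P (iota 1 n.-1))%:Z :> int.
Proof.
by rewrite -sum1_count /index_iota subn1 (big_morph Posz PoszD (erefl _)).
Qed.

(** * Liouville's method: the two convolution identities *)

Lemma count_mult3 n : count (fun a => 3 %| a)%N (iota 1 n) = (n %/ 3)%N.
Proof.
elim: n => // n IH; rewrite -(addn1 n) iotaD count_cat IH /= add1n.
by lia.
Qed.

Lemma count_nmult3 n : count (fun a => ~~ (3 %| a))%N (iota 1 (3 * n).-1) = (2 * n)%N.
Proof.
have := count_predC (fun a => 3 %| a)%N (iota 1 (3 * n).-1).
rewrite count_mult3 size_iota -/(predC (fun a => 3 %| a)%N).
set u := count _ _; lia.
Qed.

(** With chi(a) chi(b) = [a = b mod 3] - [3 | a + b], the convolution is a difference of two counts.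
    Shifting {b < a, a = b mod 3} gives {x < y, 3 | a}, and shifting {b < a, 3 | a} gives {x < y, 3
    | a + b}; so both counts reduce to solutions with 3 | a. *)
Lemma chi_sum_conv N : (N %% 3 = 2)%N ->
  3 * (\sum_(1 <= k < N) chi_sum k * chi_sum (N - k)) = sigma N.
Proof.
move=> N2; have N0 : (0 < N)%N by case: N N2.
have nz a b x y : (a * x + b * y = N -> ~~ ((3 %| a) && (3 %| b)))%N.
  by move=> e; apply/negP => /andP[/dvdnP[u ?] /dvdnP[v ?]]; subst a b; nia.
pose cnt P := qsum N P (fun _ _ _ _ => 1).
have -> : \sum_(1 <= k < N) chi_sum k * chi_sum (N - k) =
    qsum N (fun _ _ _ _ => true) (fun a b x y => chi a * chi b).
  by rewrite -(qsum_conv N (fun d _ => chi d) (fun d _ => chi d)).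
have -> : qsum N (fun _ _ _ _ => true) (fun a b x y => chi a * chi b) =
   cnt (fun a b _ _ => a %% 3 == b %% 3)%N - cnt (fun a b _ _ => 3 %| a + b)%N.
  rewrite /cnt /qsum [X in X - _]big_mkcond [X in _ - X]big_mkcond -sumrB.
  rewrite big_seq [RHS]big_seq; apply: eq_bigr => -[[a b] [x y]] /=.
  rewrite mem_quads => /and5P[_ _ _ _ /eqP /nz].
  rewrite /dvdn -modnDm /chi.
  by case: (mod3P a) => ->; case: (mod3P b) => ->.
pose P0 (a b x y : nat) := (3 %| a)%N.
have e1 : cnt (fun a b x y => (b < a) && (a %% 3 == b %% 3))%N =
  cnt (fun a b x y => (x < y) && P0 a b x y)%N.
  rewrite /cnt (qsum_shift N (fun a b x y => (a %% 3 == b %% 3)%N)); apply: eq_qsum => a b x y *.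
  by split => //; rewrite /P0; lia.
have e2 : cnt (fun a b x y => (b < a) && P0 a b x y)%N =
  cnt (fun a b x y => (x < y) && (3 %| a + b))%N.
  by rewrite /cnt (qsum_shift N P0).
have e3 : cnt (fun a b x y => (a < b) && P0 a b x y)%N =
  cnt (fun a b x y => (y < x) && P0 a b x y)%N.
  by rewrite /cnt (qsum_shift2 N P0).
have d1 : cnt (fun a b x y => (a == b))%N = \sum_(d <- divisors N) (d.-1)%:Z.
  rewrite /cnt qsum_inv.
  transitivity (qsum N (fun a b x y => (x == y) && true) (fun _ _ _ _ => 1)).
    by apply: eq_qsum => *; rewrite andbT.
  rewrite qsum_diag [RHS]sum_divisors_rev //; apply: eq_bigr => d _.
  by rewrite sum_range_count count_predT size_iota.
have d2 : cnt (fun a b x y => (x == y) && P0 a b x y)%N = \sum_(d <- divisors N) (d.-1 %/ 3)%:Z.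
  rewrite /cnt qsum_diag [RHS]sum_divisors_rev //; apply: eq_bigr => d _.
  by rewrite sum_range_count count_mult3.
have s1 : cnt (fun a b _ _ => a %% 3 == b %% 3)%N =
    cnt (fun a b x y => (b < a) && (a %% 3 == b %% 3))%N *+ 2 + cnt (fun a b x y => (a == b))%N.
  rewrite {1}/cnt (qsum_split N (fun a b _ _ => b < a)%N) -/(cnt _) mulr2n -addrA; congr (_ + _).
  rewrite (qsum_split N (fun a b _ _ => a < b)%N); congr (_ + _).
    by rewrite /cnt qsum_swap; apply: eq_qsum => a b x y *; split => //; lia.
  by apply: eq_qsum => a b x y *; split => //; lia.
(* There is no diagonal term: x = y and 3 | a + b would make N = (a + b) x divisible by 3. *)
have s2 : cnt (fun a b _ _ => 3 %| a + b)%N = cnt (fun a b x y => (x < y) && (3 %| a + b))%N *+ 2.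
  rewrite {1}/cnt (qsum_split N (fun _ _ x y => x < y)%N) -/(cnt _) mulr2n; congr (_ + _).
  rewrite /cnt qsum_swap; apply: eq_qsum => a b x y _ _ _ _ e; split => //.
  case: (ltngtP x y) => //= xy; first by rewrite addnC.
  subst y; apply/negP => /dvdnP[k ek]; nia.
(* The solutions with 3 | a are split by a against b, then by x against y. By [e3] the parts a < b
   and y < x agree, so {b < a} exceeds {x < y} exactly by the diagonal x = y. The case a = b is
   impossible here, since 3 would divide both. *)
have s3 : cnt P0 = cnt (fun a b x y => (b < a) && P0 a b x y)%N +
  cnt (fun a b x y => (a < b) && P0 a b x y)%N.
  rewrite {1}/cnt (qsum_split N (fun a b _ _ => b < a)%N) -/(cnt _); congr (_ + _).
  apply: eq_qsum => a b x y _ _ _ _ /nz; rewrite /P0 => h; split => //; lia.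
have s4 : cnt P0 = cnt (fun a b x y => (x < y) && P0 a b x y)%N +
  cnt (fun a b x y => (y < x) && P0 a b x y)%N
   + cnt (fun a b x y => (x == y) && P0 a b x y)%N.
  rewrite {1}/cnt (qsum_split N (fun _ _ x y => x < y)%N) -/(cnt _) -addrA; congr (_ + _).
  rewrite (qsum_split N (fun _ _ x y => y < x)%N); congr (_ + _).
    by apply: eq_qsum => a b x y *; split => //; lia.
  by apply: eq_qsum => a b x y *; split => //; lia.
have -> : sigma N = \sum_(d <- divisors N) (d%:Z - chi d).
  by rewrite sumrB -/(chi_sum N) chi_sum_2 // subr0.
(* Termwise: for d prime to 3, (d - 1) - 2 floor((d - 1) / 3) equals (d - chi d) / 3. *)
have -> : \sum_(d <- divisors N) (d%:Z - chi d) =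
   3 * (cnt (fun a b x y => (a == b))%N - cnt (fun a b x y => (x == y) && P0 a b x y)%N *+ 2).
  rewrite d1 d2 -sumrMnl -sumrB mulr_sumr big_seq [RHS]big_seq.
  apply: eq_bigr => d; rewrite -dvdn_divisors // => dN.
  have d3 : ~~ (3 %| d)%N by apply/negP => /dvdn_trans /(_ dN); lia.
  rewrite /chi; case: (mod3P d) => d3'; rewrite d3' /=; lia.
by lia.
Qed.

(** This expresses the restriction to k prime to 3 as a divisor sum, the form that [qsum_conv]
    accepts. *)
Lemma chi_sum_coprime3 k : (0 < k)%N ->
  \sum_(d <- divisors k) chi d ^+ 2 * chi (k %/ d)%N = if (3 %| k)%N then 0 else chi_sum k.
Proof.
move=> k0; rewrite /chi_sum [in RHS]sum_divisors_rev //.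
case: ifP => k3.
  rewrite big_seq big1 // => d; rewrite -dvdn_divisors // => dk.
  rewrite expr2 -mulrA -chiM mulnC divnK // /chi.
  by move: k3; rewrite /dvdn => /eqP ->; rewrite mulr0.
rewrite big_seq [RHS]big_seq; apply: eq_bigr => d; rewrite -dvdn_divisors // => dk.
rewrite chi_sq (_ : (3 %| d)%N = false) ?mul1r //.
by apply/negP => /dvdn_trans /(_ dk); rewrite k3.
Qed.

Lemma qsum0 N (P : nat -> nat -> nat -> nat -> bool) f :
  (forall a b x y, P a b x y -> f a b x y = 0) -> qsum N P f = 0.
Proof. by move=> H; apply: big1 => q; apply: H. Qed.

Definition nz3 (a b x y : nat) := [&& ~~ (3 %| a), ~~ (3 %| b), ~~ (3 %| x) & ~~ (3 %| y)]%N.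
(** [qA] and [qB] are the two ways in which a x + b y can be 0 mod 3 with all four entries prime to
    3: a / b is 1 or -1, and x / y is the opposite sign. [qC] is the class that links them under the
    shift. *)
Definition qA (a b x y : nat) := [&& nz3 a b x y, a %% 3 == b %% 3 & 3 %| x + y]%N.
Definition qB (a b x y : nat) := [&& nz3 a b x y, 3 %| a + b & x %% 3 == y %% 3]%N.
Definition qC (a b x y : nat) := [&& 3 %| a, 3 %| y, ~~ (3 %| b) & ~~ (3 %| x)]%N.

(* The shift and its conjugate by the swap [(a, x) <-> (b, y)] map qA to qC, qC to qB and
   qC to qC; on qC with weight [chi x * a] the last one equates the sums over
   [a < b] and [y < x]. *)
Lemma qsum_core N :
  qsum N (fun a b x y => (b < a)%N && qA a b x y) (fun a b x y => chi x * (a%:Z - b%:Z)) =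
  qsum N (fun a b x y => (x < y)%N && qB a b x y) (fun a b x y => chi x * (a%:Z + b%:Z)).
Proof.
pose f (a b x y : nat) := chi x * a%:Z.
have e0 : qsum N (fun a b x y => (a < b)%N && qC a b x y) f =
  qsum N (fun a b x y => (y < x)%N && qC a b x y) f.
  rewrite qsum_shift2; apply: eq_qsum => a b x y *; split.
    by rewrite /qC; lia.
  move=> H; rewrite /f; congr (_ * _); apply: chi_eq; move: H; rewrite /qC; lia.
have e1 : qsum N (fun a b x y => (b < a)%N && qA a b x y) (fun a b x y => chi x * (a%:Z - b%:Z)) =
    qsum N (fun a b x y => (x < y)%N && qC a b x y) f.
  rewrite qsum_shift; apply: eq_qsum => a b x y *; split; first by rewrite /qA /qC /nz3; lia.
  by move=> _; rewrite PoszD addrK.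
have e2 : qsum N (fun a b x y => (b < a)%N && qC a b x y) f =
    qsum N (fun a b x y => (x < y)%N && qB a b x y) (fun a b x y => chi x * (a%:Z + b%:Z)).
  rewrite qsum_shift; apply: eq_qsum => a b x y *; split; first by rewrite /qB /qC /nz3; lia.
  by move=> _; rewrite /f PoszD.
have s1 : qsum N qC f = qsum N (fun a b x y => (b < a)%N && qC a b x y) f +
     qsum N (fun a b x y => (a < b)%N && qC a b x y) f.
  rewrite (qsum_split N (fun a b _ _ => b < a)%N); congr (_ + _).
  by apply: eq_qsum => a b x y *; split => //; rewrite /qC; lia.
have s2 : qsum N qC f = qsum N (fun a b x y => (x < y)%N && qC a b x y) f +
     qsum N (fun a b x y => (y < x)%N && qC a b x y) f.
  rewrite (qsum_split N (fun _ _ x y => x < y)%N); congr (_ + _).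
  by apply: eq_qsum => a b x y *; split => //; rewrite /qC; lia.
lia.
Qed.

(** Write A and B for the sums of chi(x) b over [qA] and [qB]; the convolution is A + B.
    Symmetrizing under the swap, chi(x) (a - b) sums to -2A over [qA] and chi(x) (a + b) to 2B over
    [qB]. By [qsum_core] the halves b < a and x < y of these agree, so -2A = 2B - D, where D is the
    part of the second sum on x = y. *)
Lemma chi_sigma_conv m : (0 < m)%N ->
  \sum_(1 <= k < 3 * m | ~~ (3 %| k)%N) chi_sum k * sigma (3 * m - k) = 3 * chi_sq_sum m.
Proof.
move=> m0; set N := (3 * m)%N.
pose f (a b x y : nat) := chi x * a%:Z; pose g (a b x y : nat) := chi x * b%:Z.
have -> : \sum_(1 <= k < N | ~~ (3 %| k)%N) chi_sum k * sigma (N - k) =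
    qsum N (fun _ _ _ _ => true) (fun a b x y => chi a ^+ 2 * chi x * b%:Z).
  rewrite -(qsum_conv N (fun d e => chi d ^+ 2 * chi e) (fun d _ => d%:Z)).
  rewrite big_mkcond big_nat [RHS]big_nat; apply: eq_bigr => k /andP[k0 _].
  by rewrite chi_sum_coprime3 //; case: (3 %| k)%N; rewrite ?mul0r.
(* A nonzero weight forces a x, hence also b y, to be prime to 3; such solutions lie in [qA] or
   [qB]. *)
have -> : qsum N (fun _ _ _ _ => true) (fun a b x y => chi a ^+ 2 * chi x * b%:Z) =
  qsum N qA g + qsum N qB g.
  rewrite (qsum_split N qA); congr (_ + _).
    apply: eq_qsum => a b x y *; split; rewrite ?andbT // => H.
    by rewrite chi_sq (_ : ~~ (3 %| a)%N = true) ?mul1r //; move: H; rewrite /qA /nz3; lia.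
  rewrite (qsum_split N qB) -[RHS]addr0; congr (_ + _).
    apply: eq_qsum => a b x y *; split; first by rewrite /qA /qB /nz3; lia.
    by move=> H; rewrite chi_sq (_ : ~~ (3 %| a)%N = true) ?mul1r //; move: H;
      rewrite /qB /nz3; lia.
  rewrite -(@qsum0 N (fun _ _ _ _ => false) g) //.
  rewrite /qsum big_mkcond [RHS]big_mkcond big_seq [RHS]big_seq.
  apply: eq_bigr => -[[a b] [x y]]; rewrite mem_quads /= => /and5P[_ _ _ _ /eqP e].
  have : (((a %% 3) * (x %% 3) + (b %% 3) * (y %% 3)) %% 3 = 0)%N.
    by rewrite -modnDm !modnMm modnDm e /N modnMr.
  rewrite andbT chi_sq /qA /qB /nz3 /dvdn -(modnDm a b) -(modnDm x y) /chi.
  by case: (mod3P a) => ->; case: (mod3P b) => ->; case: (mod3P x) => ->; case: (mod3P y) => ->;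
    rewrite //= ?mul0r ?mulr0 ?mul0r.
have sA : qsum N qA f = - qsum N qA g.
  rewrite qsum_swap /qsum -sumrN; apply: eq_big => [q|q /and3P[_ _ H]].
    by rewrite /qA /nz3; lia.
  by rewrite /f /g (@chi_opp _ q.2.1) ?mulNr.
have sB : qsum N qB f = qsum N qB g.
  rewrite qsum_swap; apply: eq_qsum => a b x y *; split; first by rewrite /qB /nz3; lia.
  by move=> /and3P[_ _ /eqP H]; rewrite /f /g (@chi_eq y x).
have tA : qsum N qA (fun a b x y => chi x * (a%:Z - b%:Z)) = - qsum N qA g *+ 2.
  have -> : qsum N qA (fun a b x y => chi x * (a%:Z - b%:Z)) = qsum N qA f - qsum N qA g.
    by rewrite /qsum -sumrB; apply: eq_bigr => q _; rewrite mulrBr.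
  by rewrite sA mulr2n.
have tB : qsum N qB (fun a b x y => chi x * (a%:Z + b%:Z)) = qsum N qB g *+ 2.
  have -> : qsum N qB (fun a b x y => chi x * (a%:Z + b%:Z)) = qsum N qB f + qsum N qB g.
    by rewrite /qsum -big_split; apply: eq_bigr => q _; rewrite mulrDr.
  by rewrite sB mulr2n.
have uA : qsum N qA (fun a b x y => chi x * (a%:Z - b%:Z)) =
    qsum N (fun a b x y => (b < a)%N && qA a b x y) (fun a b x y => chi x * (a%:Z - b%:Z)) *+ 2.
  rewrite (qsum_split N (fun a b _ _ => b < a)%N) mulr2n; congr (_ + _).
  rewrite (qsum_split N (fun a b _ _ => a < b)%N) -[RHS]addr0; congr (_ + _).
    rewrite qsum_swap; apply: eq_qsum => a b x y *; split; first by rewrite /qA /nz3; lia.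
    by move=> H; rewrite (@chi_opp y x) ?mulNr -?mulrN ?opprB //; move: H; rewrite /qA; lia.
  apply: qsum0 => a b x y H; have -> : a = b by lia.
  by rewrite subrr mulr0.
have uB : qsum N qB (fun a b x y => chi x * (a%:Z + b%:Z)) =
    qsum N (fun a b x y => (x < y)%N && qB a b x y) (fun a b x y => chi x * (a%:Z + b%:Z)) *+ 2 +
    qsum N (fun a b x y => (x == y)%N && qB a b x y) (fun a b x y => chi x * (a%:Z + b%:Z)).
  rewrite (qsum_split N (fun _ _ x y => x < y)%N) mulr2n -addrA; congr (_ + _).
  rewrite (qsum_split N (fun _ _ x y => y < x)%N); congr (_ + _).
    rewrite qsum_swap; apply: eq_qsum => a b x y *; split; first by rewrite /qB /nz3; lia.
    by move=> H; rewrite (@chi_eq y x) 1?addrC //; move: H; rewrite /qB; lia.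
  by apply: eq_qsum => a b x y *; split => //; lia.
(* On x = y = d with d prime to 3, d divides m, and a + b = 3e with e = m / d. There are 2e
   admissible a, each contributing 3e chi(d). *)
have D : qsum N (fun a b x y => (x == y)%N && qB a b x y) (fun a b x y => chi x * (a%:Z +
  b%:Z)) = 6 * chi_sq_sum m.
  rewrite qsum_diag (bigID (fun d => 3 %| d)%N) /= big1 ?add0r; last first.
    move=> d d3; apply: big1 => a _; rewrite /chi; move: d3; rewrite /dvdn => /eqP ->.
    by rewrite mul0r.
  rewrite /chi_sq_sum mulr_sumr [RHS](bigID (fun d => 3 %| d)%N) /= [X in _ =
    X + _]big1 ?add0r; last first.
    by move=> d; rewrite /dvdn => /eqP d3; rewrite /chi d3 mul0r mulr0.
  have N0 : (0 < N)%N by rewrite muln_gt0.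
  rewrite [LHS](@big_seq_bij _ _ _ (divisors m) (divisors N) (fun d => ~~ (3 %| d))%N _ id)
    ?divisors_uniq //; last first.
  - move=> d; rewrite -dvdn_divisors // => dN d3; exists d => //;
    rewrite d3 andbT -dvdn_divisors //.
    by move: dN; rewrite /N Gauss_dvdr // coprime_sym prime_coprime.
  - by move=> d; rewrite -!dvdn_divisors // => dm ->; rewrite dvdn_mull.
  rewrite big_seq_cond [RHS]big_seq_cond; apply: eq_bigr => d.
  rewrite -dvdn_divisors // => /andP[dm d3].
  rewrite /N -muln_divA //; set e := (m %/ d)%N.
  transitivity (\sum_(1 <= a < 3 * e | ~~ (3 %| a)%N) chi d * (3 * e)%:Z).
    rewrite big_mkcond [RHS]big_mkcond big_nat [RHS]big_nat; apply: eq_bigr => a ae.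
    rewrite (_ : qB _ _ _ _ = ~~ (3 %| a)%N); last by rewrite /qB /nz3; lia.
    by case: ifP => // _; rewrite -PoszD subnKC //; lia.
  rewrite -[X in \sum_(_ <= _ < _ | _) X]mulr1 -mulr_sumr sum_range_count count_nmult3.
  by rewrite !PoszM; ring.
have := qsum_core N.
lia.
Qed.

(** * Divisor sums and multiplicativity *)

Lemma sum_divisors_pfactor p k m (F : nat -> int) : prime p -> (0 < m)%N -> ~~ (p %| m)%N ->
  \sum_(d <- divisors (p ^ k * m)) F d =
  \sum_(i < k.+1) \sum_(e <- divisors m) F (p ^ i * e)%N.
Proof.
move=> pp m0 pm.
have p0 := prime_gt0 pp.
have N0 : (0 < p ^ k * m)%N by rewrite muln_gt0 expn_gt0 p0.
rewrite -(big_mkord predT (fun i => \sum_(e <- divisors m) F (p ^ i * e)%N)).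
pose t := [seq (i, e) | i <- index_iota 0 k.+1, e <- divisors m].
transitivity (\sum_(z <- t) F (p ^ z.1 * z.2)%N); last by rewrite big_allpairs_dep.
have tP i e : (i, e) \in t -> [/\ (i <= k)%N, (e %| m)%N, (0 < e)%N & logn p (p ^ i * e) = i].
  case/allpairsPdep=> i' [e' [+ + [-> ->]]]; rewrite mem_index_iota -dvdn_divisors // => ik em.
  have e0 := dvdn_gt0 m0 em; split => //.
  rewrite lognM ?expn_gt0 ?p0 // pfactorK // logn_coprime ?addn0 // prime_coprime //.
  by apply: contra pm => /dvdn_trans; apply.
apply: (@big_seq_bij _ _ _ t _ predT _ (fun z : nat * nat => (p ^ z.1 * z.2)%N)).
- apply: allpairs_uniq_dep; rewrite ?iota_uniq //; last by move=> [? ?] [? ?] _ _ /= [-> ->].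
  by move=> *; apply: divisors_uniq.
- exact: divisors_uniq.
- move=> [i e] /tP[ik em _ _] _ /=; rewrite andbT -dvdn_divisors //.
  by apply: dvdn_mul => //; apply: dvdn_exp2l.
- move=> [i e] [i' e'] /tP[_ _ e0 /= l1] /tP[_ _ e0' /= l2] _ _ /= E.
  have ii : i = i' by rewrite -l1 -l2 E.
  subst i'; congr (_, _); apply/eqP; rewrite -(@eqn_pmul2l (p ^ i)) ?E //.
  by rewrite expn_gt0 p0.
- move=> d; rewrite -dvdn_divisors // => dN _.
  have d0 := dvdn_gt0 N0 dN.
  have [e pe dE] := pfactor_coprime pp d0.
  exists (logn p d, e); last by rewrite /= mulnC.
  rewrite andbT; apply/allpairsPdep; exists (logn p d), e; split => //.
    rewrite mem_index_iota /= ltnS.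
    have := dvdn_leq_log p N0 dN; rewrite lognM ?expn_gt0 ?p0 // pfactorK //.
    by rewrite (@logn_coprime p m) ?prime_coprime // addn0.
  rewrite -dvdn_divisors // -(@Gauss_dvdr _ (p ^ k)) //; last by rewrite coprime_sym coprimeXl.
  by apply: dvdn_trans dN; rewrite [X in (_ %| X)%N]dE dvdn_mulr.
Qed.

Lemma chiX p i : chi (p ^ i) = chi p ^+ i.
Proof. by elim: i => [|i IH] //; rewrite expnS chiM IH exprS. Qed.

Lemma chi_sum_pfactor p k m : prime p -> (0 < m)%N -> ~~ (p %| m)%N ->
  chi_sum (p ^ k * m) = (\sum_(i < k.+1) chi p ^+ i) * chi_sum m.
Proof.
move=> pp m0 pm; rewrite /chi_sum sum_divisors_pfactor // mulr_suml.
apply: eq_bigr => i _; rewrite mulr_sumr; apply: eq_bigr => e _.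
by rewrite chiM chiX.
Qed.

Lemma chi_sq_sum_pfactor p k m : prime p -> (0 < m)%N -> ~~ (p %| m)%N ->
  chi_sq_sum (p ^ k * m) = (\sum_(i < k.+1) chi p ^+ i * p%:Z ^+ (2 * (k - i))) * chi_sq_sum m.
Proof.
move=> pp m0 pm; rewrite /chi_sq_sum sum_divisors_pfactor // mulr_suml.
apply: eq_bigr => -[i ik] _ /=; rewrite mulr_sumr big_seq [RHS]big_seq; apply: eq_bigr => e.
rewrite -dvdn_divisors // => em.
have e0 := dvdn_gt0 m0 em.
rewrite chiM chiX -(subnKC (ik : i <= k)%N) expnD -mulnA divnMl ?expn_gt0 ?prime_gt0 //.
rewrite -muln_divA // subnKC // PoszM exprMn exprM.
rewrite (_ : (p ^ (k - i))%N%:Z = p%:Z ^+ (k - i)); last by rewrite -!natz natrX.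
by rewrite -!exprM (mulnC _ 2) [_ * chi e]mulrC; ring.
Qed.

Lemma prod_over_primes (R : comPzRingType) (f : nat -> R) (g : nat -> nat -> R) :
  f 1%N = 1 ->
  (forall p k m, prime p -> (0 < m)%N -> ~~ (p %| m)%N -> f (p ^ k * m)%N = g p k * f m) ->
  forall n, (0 < n)%N -> f n = \prod_(p <- primes n) g p (logn p n).
Proof.
move=> f1 fM n n0.
have key (e : nat -> nat) l : uniq l -> all prime l ->
    f (\prod_(p <- l) p ^ e p)%N = \prod_(p <- l) g p (e p).
  elim: l => [|p l IH]; first by rewrite !big_nil.
  move=> /= /andP[pl ul] /andP[pp al]; rewrite !big_cons fM ?IH //.
    by rewrite big_seq prodn_cond_gt0 // => q ql; rewrite expn_gt0 prime_gt0 //; apply: (allP al).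
  rewrite big_seq; apply: (big_ind (fun z => ~~ (p %| z)%N)) => [|x y px py|q ql].
  - by rewrite dvdn1 gtn_eqF ?prime_gt1.
  - by rewrite Euclid_dvdM // negb_or px.
  - rewrite Euclid_dvdX // dvdn_prime2 //; last exact: (allP al).
    by rewrite negb_and; apply/orP; left; apply: contra pl => /eqP ->.
rewrite -(key (fun p => logn p n)) ?primes_uniq //.
  by rewrite {1}(prod_prime_decomp n0) prime_decompE big_map.
by apply/allP => p; rewrite mem_primes => /and3P[].
Qed.

(** The local factor at p is a geometric sum with closed form (p^(2k+2) - chi(p)^(k+1)) / (p^2 -
    chi(p)). The values 1, -1 and 0 of chi(p) give the three kinds of factor, the last one only for
    p = 3. *)
Lemma chi_sq_sum_prod n :
  (chi_sq_sum n.+1)%:~R =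
    (3%:R : rat) ^+ (2 * logn 3 n.+1)
  * \prod_(p <- primes n.+1 | (p %% 3 == 1)%N)
       ((p%:R ^+ (2 * (logn p n.+1).+1) - 1) / (p%:R ^+ 2 - 1))
  * \prod_(q <- primes n.+1 | (q %% 3 == 2)%N)
       ((q%:R ^+ (2 * logn q n.+1 + 2) + (-1) ^+ logn q n.+1) / (q%:R ^+ 2 + 1)).
Proof.
set N := n.+1.
pose g p k : rat := \sum_(i < k.+1) (chi p)%:~R ^+ i * p%:R ^+ (2 * (k - i)).
have gE p k : prime p -> g p k =
    ((p%:R ^+ 2) ^+ k.+1 - (chi p)%:~R ^+ k.+1) / (p%:R ^+ 2 - (chi p)%:~R).
  move=> pp; have p1 := prime_gt1 pp.
  have nz : (p%:R : rat) ^+ 2 - (chi p)%:~R != 0.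
    rewrite subr_eq0 -natrX pmulrn eqr_int.
    have : (1 < p ^ 2)%N by rewrite -[1%N](exp1n 2) ltn_exp2r.
    by rewrite /chi; case: (mod3P p) => -> /=; lia.
  apply: (canRL (mulfK nz)); rewrite subrXX mulrC; congr (_ * _).
  by apply: eq_bigr => i _; rewrite mulrC exprM.
have -> : (chi_sq_sum N)%:~R = \prod_(p <- primes N) g p (logn p N).
  apply: (@prod_over_primes _ (fun n => (chi_sq_sum n)%:~R)) => //.
    by rewrite /chi_sq_sum big_seq1.
  move=> p k m pp m0 pm; rewrite chi_sq_sum_pfactor // rmorphM; congr (_ * _).
  rewrite rmorph_sum; apply: eq_bigr => i _.
  by rewrite rmorphM !rmorphXn.
have pr p : p \in primes N -> prime p by rewrite mem_primes => /andP[].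
rewrite (bigID (fun p => p %% 3 == 1)%N) [X in _ * X = _](bigID (fun p => p %% 3 == 2)%N) /=.
rewrite mulrCA mulrC; congr (_ * _); last first.
  rewrite big_seq_cond [RHS]big_seq_cond; apply: eq_big => [p|p /and3P[pN _ /eqP p2]].
    by congr (_ && _); case: (mod3P p) => ->.
  rewrite gE ?pr // /chi p2 /= -exprM sub0r mulrN1z opprK exprS mulN1r opprK.
  by congr ((_ ^+ _ + _) / _); lia.
rewrite mulrC; congr (_ * _); last first.
  rewrite big_seq_cond [RHS]big_seq_cond; apply: eq_bigr => p /andP[pN /eqP p1].
  by rewrite gE ?pr // /chi p1 /= -exprM subr0 expr1n.
have -> : \prod_(p <- primes N | (p %% 3 != 1)%N && (p %% 3 != 2)%N) g p (logn p N) =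
   \prod_(p <- primes N | p == 3) g p (logn p N).
  rewrite big_seq_cond [RHS]big_seq_cond; apply: eq_bigl => p.
  case: (boolP (p \in primes N)) => //= /pr pp.
  rewrite (eq_sym p) -(dvdn_prime2 (isT : prime 3)) // /dvdn.
  by case: (mod3P p) => ->.
case: (boolP (3 \in primes N)) => [p3|p3].
  rewrite -big_filter filter_pred1_uniq ?primes_uniq // big_seq1 gE ?pr //.
  by rewrite /chi /= subr0 expr0n subr0 exprS mulrAC divff // mul1r exprM.
rewrite (_ : logn 3 N = 0%N) ?muln0 ?expr0.
  rewrite big_seq_cond big1 // => p /andP[pN /eqP p3']; subst p; by rewrite pN in p3.
by apply/eqP; rewrite -leqn0 leqNgt logn_gt0.
Qed.

(** * Eisenstein integers of given norm *)

(* The pair [(x, y)] stands for [x + y w] with [w ^ 2 + w + 1 = 0]; [eprim] says that it is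
   congruent to 1 modulo [1 - w]. *)
Definition enorm (z : int * int) : int := z.1 ^+ 2 - z.1 * z.2 + z.2 ^+ 2.
Definition emul (z w : int * int) : int * int :=
  (z.1 * w.1 - z.2 * w.2, z.1 * w.2 + z.2 * w.1 - z.2 * w.2).
Definition econj (z : int * int) : int * int := (z.1 - z.2, - z.2).
Definition eprim (z : int * int) : bool := (3 %| z.1 + z.2 - 1)%Z.

Definition centered (B : nat) : seq int := [seq k%:Z - B%:Z | k <- iota 0 (2 * B).+1].
Definition eis (M : nat) : seq (int * int) :=
  [seq z <- [seq (x, y) | x <- centered M, y <- centered M] | (enorm z == M%:Z) && eprim z].

Lemma enormM z w : enorm (emul z w) = enorm z * enorm w.
Proof. by rewrite /enorm /=; ring. Qed.

Lemma enorm_conj z : enorm (econj z) = enorm z.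
Proof. by rewrite /enorm /=; ring. Qed.

Lemma emul_conj z w : emul (econj z) (emul z w) = (enorm z * w.1, enorm z * w.2).
Proof. by rewrite /emul /enorm /=; congr (_, _); ring. Qed.

Lemma econjK z : econj (econj z) = z.
Proof. by case: z => a b; rewrite /econj /=; congr (_, _); ring. Qed.

Lemma mem_centered (B : nat) (x : int) : (x \in centered B) = (`|x| <= B)%N.
Proof.
apply/mapP/idP => [[k + ->]|xB]; first by rewrite mem_iota; lia.
by exists (absz (x + B%:Z)); rewrite ?mem_iota; lia.
Qed.

Lemma uniq_centered B : uniq (centered B).
Proof. by rewrite map_inj_in_uniq ?iota_uniq // => i j _ _; lia. Qed.

Lemma uniq_eis M : uniq (eis M).
Proof.
apply: filter_uniq; apply: allpairs_uniq; rewrite ?uniq_centered //.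
by move=> [? ?] [? ?] _ _ [-> ->].
Qed.

Lemma mem_eis M z : (z \in eis M) = (enorm z == M%:Z) && eprim z.
Proof.
rewrite mem_filter andb_idr // => /andP[/eqP].
case: z => x y e _; have {}e : x ^+ 2 - x * y + y ^+ 2 = M%:Z by [].
have bnd (u v : int) : u ^+ 2 - u * v + v ^+ 2 = M%:Z -> (`|u| <= M)%N.
  (* Four times the norm is 3 u^2 + (2v - u)^2, so 3 u^2 is at most 4M. *)
  move=> E; have F : u ^+ 2 * 3 + (2 * v - u) ^+ 2 = 4 * M%:Z by rewrite -E; ring.
  have := sqr_ge0 (2 * v - u); case: M {e} E F => [|M] E F G; nia.
apply/allpairsP; exists (x, y); rewrite !mem_centered /=; split => //.
  exact: bnd e.
by apply: (bnd y x); rewrite -e; ring.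
Qed.

Definition eis_num (M : nat) : int := \sum_(z <- eis M) 1.

(** Of the six units, 1, w and w^2 = -1 - w are 1 modulo 1 - w. *)
Lemma eis_num1 : eis_num 1 = 3.
Proof.
have -> : eis_num 1 = \sum_(z <- [:: (-1, -1); (0, 1); (1, 0)] : seq (int * int)) 1.
  by rewrite /eis_num; congr bigop; vm_compute.
by rewrite !big_cons big_nil.
Qed.

Lemma dvdz_primeM (p : nat) x y : prime p -> (p%:Z %| x * y)%Z = (p%:Z %| x)%Z || (p%:Z %| y)%Z.
Proof. by move=> pp; rewrite !dvdzE abszM Euclid_dvdM. Qed.

Lemma dvdz_prime_sqr (p : nat) x : prime p -> (p%:Z %| x ^+ 2)%Z = (p%:Z %| x)%Z.
Proof. by move=> pp; rewrite expr2 dvdz_primeM // orbb. Qed.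

(** Reduction modulo 1 - w sends w to 1, so x + y modulo 3 is multiplicative. *)
Lemma eprimM z w : eprim z -> eprim (emul z w) = eprim w.
Proof.
rewrite /eprim /= => /dvdzP[k zE].
have -> : z.1 * w.1 - z.2 * w.2 + (z.1 * w.2 + z.2 * w.1 - z.2 * w.2) - 1 =
  w.1 + w.2 - 1 + (k * (w.1 + w.2) - z.2 * w.2) * 3.
  have -> : z.1 = k * 3 + 1 - z.2 by lia.
  by ring.
by rewrite rpredDr // dvdz_mull.
Qed.

(** Here [q] is signed, because scaling preserves [eprim] only for q = 1 mod 3: it will be p for
    split primes and -p for inert ones. *)
Lemma eis_scale (q : int) M : (3 %| q - 1)%Z ->
  \sum_(z <- eis (`|q| ^ 2 * M) | (q %| z.1)%Z && (q %| z.2)%Z) 1 = eis_num M.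
Proof.
move=> q3; have q0 : q != 0 by apply: contraTneq q3 => ->.
have En (z : int * int) : enorm (q * z.1, q * z.2) = q ^+ 2 * enorm z by rewrite /enorm /=; ring.
have Ep (z : int * int) : eprim (q * z.1, q * z.2) = eprim z.
  move: q3; rewrite /eprim /= => /dvdzP[k kE].
  have -> : q * z.1 + q * z.2 - 1 = z.1 + z.2 - 1 + (k * (z.1 + z.2)) * 3.
    by rewrite (_ : q = k * 3 + 1); [ring | lia].
  by rewrite rpredDr // dvdz_mull.
have qM : (`|q| ^ 2 * M)%N%:Z = q ^+ 2 * M%:Z by rewrite PoszM -abszX abszE ger0_norm ?sqr_ge0.
apply: (@big_seq_bij _ _ _ (eis M) _ xpredT _ (fun z => (q * z.1, q * z.2)));
  rewrite ?uniq_eis //.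
- move=> z; rewrite !mem_eis En Ep qM => /andP[/eqP -> ->] _ /=.
  by rewrite eqxx !dvdz_mulr.
- move=> [x y] [x' y'] _ _ _ _ /= [E1 E2].
  by rewrite (mulfI q0 E1) (mulfI q0 E2).
- move=> [x y]; rewrite mem_eis qM /= => /andP[/eqP nE pE] /andP[/dvdzP[x' xE] /dvdzP[y' yE]].
  subst x y; exists (x', y'); last by rewrite /= !(mulrC q).
  rewrite andbT mem_eis; move: nE pE; rewrite !(mulrC _ q) -/((q * (x', y').1, q * (x', y').2)).
  rewrite (En (x', y')) (Ep (x', y')) => nE ->; rewrite andbT.
  by apply/eqP; apply: mulfI nE; rewrite expf_eq0.
Qed.

(* For [u] of prime norm [p], this is divisibility of [z] by [u]: the expression is the
   second coordinate of [econj u * z], and it controls the first one through the norm. *)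
Definition ediv (p : nat) (u z : int * int) : bool := (p%:Z %| z.2 * u.1 - u.2 * z.1)%Z.

(** Multiplication by [u] is the bijection; its inverse is multiplication by [econj u] followed by
    division by p. *)
Lemma eis_ediv (p : nat) u M : prime p -> enorm u = p%:Z -> eprim u ->
  \sum_(z <- eis (p * M) | ediv p u z) 1 = eis_num M.
Proof.
move=> pp up u3.
have p0 : p%:Z != 0 by have := prime_gt0 pp; lia.
apply: (@big_seq_bij _ _ _ (eis M) _ xpredT _ (emul u)); rewrite ?uniq_eis //.
- move=> z; rewrite !mem_eis enormM eprimM // up PoszM => /andP[/eqP -> ->] _.
  rewrite eqxx /= /ediv /=.
  have -> : (u.1 * z.2 + u.2 * z.1 - u.2 * z.2) * u.1 - u.2 * (u.1 * z.1 - u.2 * z.2) =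
    z.2 * enorm u.
    by rewrite /enorm; ring.
  by rewrite up dvdz_mull.
- move=> [x y] [x' y'] _ _ _ _ E.
  have := emul_conj u (x, y); rewrite E emul_conj up /= => -[E1 E2].
  by rewrite (mulfI p0 E1) (mulfI p0 E2).
- move=> w; rewrite mem_eis => /andP[/eqP wn w3] uw.
  set v := emul (econj u) w.
  have vn : enorm v = p%:Z * (p * M)%N%:Z by rewrite enormM enorm_conj up wn.
  have p2 : (p%:Z %| v.2)%Z.
    have -> : v.2 = w.2 * u.1 - u.2 * w.1 by rewrite /v /=; ring.
    exact: uw.
  have p1 : (p%:Z %| v.1)%Z.
    rewrite -dvdz_prime_sqr //.
    have -> : v.1 ^+ 2 = enorm v + (v.1 - v.2) * v.2 by rewrite /enorm; ring.
    by rewrite rpredDr ?dvdz_mull // vn dvdz_mulr.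
  move/dvdzP: p1 => [x xE]; move/dvdzP: p2 => [y yE].
  have uv : emul u (x, y) = w.
    have := emul_conj (econj u) w; rewrite econjK enorm_conj up -/v.
    have -> : emul u v = (p%:Z * (emul u (x, y)).1, p%:Z * (emul u (x, y)).2).
      by rewrite /emul xE yE /=; congr (_, _); ring.
    by case: (emul u (x, y)) (w) => [a b] [c d] /= [/(mulfI p0) -> /(mulfI p0) ->].
  exists (x, y) => //; rewrite andbT mem_eis -(eprimM u (x, y) u3) uv w3 andbT.
  apply/eqP/(mulfI p0); rewrite -PoszM -wn -uv enormM up.
  by [].
Qed.

(** Inclusion-exclusion: an element whose norm is divisible by p is divisible by [u] or by
    [econj u], and by both exactly when p divides it. *)
Lemma eis_split (p : nat) u M : prime p -> (p %% 3 = 1)%N -> enorm u = p%:Z -> eprim u ->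
  eis_num (p * M) = 2 * eis_num M - (if (p %| M)%N then eis_num (M %/ p)%N else 0).
Proof.
move=> pp p3 up u3.
have p0 := prime_gt0 pp.
have both z : (p%:Z %| enorm z)%Z ->
   ediv p u z && ediv p (econj u) z = ((p%:Z %| z.1) && (p%:Z %| z.2))%Z.
  move=> zn; apply/andP/andP => [[d1 d2]|[d1 d2]]; last first.
    by rewrite /ediv; split; apply: rpredB; first [exact: dvdz_mulr | exact: dvdz_mull].
  have p3' : (p%:Z %| 3)%Z = false by rewrite dvdzE /= dvdn_prime2 //; apply/eqP => e;
    rewrite e in p3.
  have p2' : (p%:Z %| 2)%Z = false by rewrite dvdzE /= dvdn_prime2 //; apply/eqP => e;
    rewrite e in p3.
  (* Otherwise p would divide both coordinates of [u], and p^2 would divide its norm p. *)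
  have db : (p%:Z %| u.2)%Z = false.
    apply/negP => db.
    have da : (p%:Z %| u.1)%Z.
      rewrite -dvdz_prime_sqr // (_ : u.1 ^+ 2 = enorm u + (u.1 - u.2) * u.2);
        last by rewrite /enorm; ring.
      by rewrite rpredDr ?dvdz_mull // up.
    move/dvdzP: da => [k kE]; move/dvdzP: db => [l lE].
    have e : p%:Z * (p%:Z * (k ^+ 2 - k * l + l ^+ 2)) = p%:Z * 1.
      by rewrite mulr1 -[in RHS]up /enorm kE lE; ring.
    have p0' : p%:Z != 0 by lia.
    have : (p%:Z %| p%:Z * (k ^+ 2 - k * l + l ^+ 2))%Z by exact: dvdz_mulr.
    rewrite (mulfI p0' e).
    by rewrite dvdzE /= dvdn1 => /eqP e1; rewrite e1 in pp.
  have d3 : (p%:Z %| 2 * z.1 - z.2)%Z.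
    have : (p%:Z %| u.2 * (2 * z.1 - z.2))%Z.
      have -> : u.2 * (2 * z.1 - z.2) =
        (z.2 * (econj u).1 - (econj u).2 * z.1) - (z.2 * u.1 - u.2 * z.1).
        by rewrite /=; ring.
      exact: rpredB.
    by rewrite dvdz_primeM // db.
  have d4 : (p%:Z %| z.2)%Z.
    have : (p%:Z %| 3 * z.2 ^+ 2)%Z.
      have -> : 3 * z.2 ^+ 2 = enorm z * 4 - (2 * z.1 - z.2) ^+ 2 by rewrite /enorm; ring.
      by rewrite rpredB ?dvdz_mulr // expr2 dvdz_mulr.
    by rewrite dvdz_primeM // p3' dvdz_prime_sqr.
  split=> //.
  have : (p%:Z %| 2 * z.1)%Z by rewrite (_ : 2 * z.1 = (2 * z.1 - z.2) + z.2);
    [exact: rpredD|ring].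
  by rewrite dvdz_primeM // p2'.
(* The product of the two divisibility expressions is z.2^2 N(u) - u.2^2 N(z), and both norms are
   divisible by p. *)
have either z : (p%:Z %| enorm z)%Z -> ediv p u z || ediv p (econj u) z.
  move=> zn; rewrite /ediv -dvdz_primeM //=.
  rewrite (_ : _ * _ = z.2 ^+ 2 * enorm u - u.2 ^+ 2 * enorm z).
    by rewrite up rpredB ?dvdz_mull.
  by rewrite /enorm; ring.
have zn z : z \in eis (p * M) -> (p%:Z %| enorm z)%Z.
  by rewrite mem_eis PoszM => /andP[/eqP -> _]; rewrite dvdz_mulr.
have e1 := eis_ediv p u M pp up u3.
have e2 : \sum_(z <- eis (p * M) | ediv p (econj u) z) 1 = eis_num M.
  apply: eis_ediv; rewrite ?enorm_conj //.
  by move: u3; rewrite /eprim /=; lia.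
have e3 : \sum_(z <- eis (p * M) | ediv p u z && ediv p (econj u) z) 1 =
    if (p %| M)%N then eis_num (M %/ p)%N else 0.
  rewrite big_seq_cond.
  under eq_bigl => z do rewrite (andb_id2l (fun H => both z (zn z H))).
  rewrite -big_seq_cond.
  case: ifP => pM.
    rewrite -(eis_scale p%:Z) /=; last by lia.
    by rewrite -mulnn -mulnA (mulnC p (M %/ p)%N) divnK.
  rewrite big_seq_cond big1 // => z /and3P[+ /dvdzP[x xE] /dvdzP[y yE]].
  rewrite mem_eis /enorm xE yE => /andP[/eqP e _].
  have : p%:Z * (p%:Z * (x ^+ 2 - x * y + y ^+ 2)) = p%:Z * M%:Z by rewrite -PoszM -e; ring.
  move/mulfI => /(_ _); rewrite (_ : p%:Z != 0 = true) => [/(_ isT) e'|]; last by lia.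
  have : (p%:Z %| M%:Z)%Z by rewrite -e' dvdz_mulr.
  by rewrite dvdzE /= pM.
rewrite -e3.
have : eis_num (p * M) = \sum_(z <- eis (p * M) | ediv p u z) 1 +
    \sum_(z <- eis (p * M) | ediv p (econj u) z) 1 -
      \sum_(z <- eis (p * M) | ediv p u z && ediv p (econj u) z) 1.
  rewrite /eis_num [X in X + _ - _]big_mkcond [X in _ + X - _]big_mkcond [X in _ - X]big_mkcond.
  rewrite -big_split -sumrB big_seq [RHS]big_seq; apply: eq_bigr => z /zn /either /=.
  by case: ediv; case: ediv.
by rewrite e1 e2 => ->; rewrite mulr2n mulrDl !mul1r.
Qed.

(** * Inert primes, split primes, and the count of elements of given norm *)

Lemma intr_Fp_eq0 (p : nat) (x : int) : prime p -> (x%:~R == 0 :> 'F_p) = (p%:Z %| x)%Z.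
Proof.
move=> pp; rewrite -(dvdz_pcharf (pchar_Fp pp)).
by [].
Qed.

Lemma Fp_frobenius (p : nat) (u : 'F_p) : prime p -> u ^+ p = u.
Proof. by move=> pp; rewrite -{2}(expf_card u) card_Fp. Qed.

(* If [p] divides [x ^ 2 - x y + y ^ 2] then [x ^ 3 = (- y) ^ 3] modulo [p], and cubing is
   injective modulo [p]. *)
Lemma inert_dvd (p : nat) z : prime p -> (p %% 3 = 2)%N -> (p%:Z %| enorm z)%Z ->
  (p%:Z %| z.1)%Z && (p%:Z %| z.2)%Z.
Proof.
case: z => x y pp p3; rewrite -!(intr_Fp_eq0 p) // /enorm /=.
rewrite rmorphD rmorphB !rmorphXn rmorphM /=.
set u : 'F_p := x%:~R; set v : 'F_p := y%:~R => /eqP e.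
have three : (3%:R : 'F_p) != 0.
  rewrite -[3%:R]/((3 : int)%:~R) intr_Fp_eq0 // dvdzE /= dvdn_prime2 //.
  by apply/eqP => e3; rewrite e3 in p3.
have e3 : u ^+ 3 = (- v) ^+ 3.
  apply/eqP; rewrite -subr_eq0; apply/eqP.
  by transitivity ((u + v) * (u * u - u * v + v * v)); [ring | rewrite -!expr2 e mulr0].
(* As p = 3q + 2, Fermat's theorem recovers w from its cube: (w^3)^q w^2 = w. *)
have pE : p = (3 * (p %/ 3) + 2)%N by lia.
have frob (w : 'F_p) : (w ^+ 3) ^+ (p %/ 3) * w ^+ 2 = w.
  by rewrite -exprM -exprD -pE Fp_frobenius.
have uv : u = - v.
  have [u0|u0] := eqVneq u 0.
    move/eqP: e3; rewrite u0 expr0n /= eq_sym expf_eq0 /= => /eqP ->.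
    by [].
  have [v0|v0] := eqVneq (- v) 0.
    move/eqP: e3; rewrite v0 expr0n /= expf_eq0 /= => /eqP ->.
    by [].
  have h (w : 'F_p) : w != 0 -> (w ^+ 3) ^+ (p %/ 3) * w = 1.
    by move=> w0; apply: (mulIf w0); rewrite mul1r -mulrA -expr2 frob.
  have hu := h _ u0; have hv := h _ v0; rewrite -e3 in hv.
  have n0 : (u ^+ 3) ^+ (p %/ 3) != 0 by rewrite !expf_neq0.
  by apply: (mulfI n0); rewrite hu hv.
have v0 : v = 0.
  move: e; rewrite uv => e.
  have : 3%:R * v ^+ 2 = 0 by rewrite -e; ring.
  by move/eqP; rewrite mulf_eq0 (negbTE three) expf_eq0 /= => /eqP.
by rewrite uv v0 oppr0 eqxx.
Qed.

(** All elements of norm p M are multiples of p; they are divided by -p, which is 1 mod 3. *)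
Lemma eis_inert (p : nat) M : prime p -> (p %% 3 = 2)%N ->
  eis_num (p * M) = if (p %| M)%N then eis_num (M %/ p)%N else 0.
Proof.
move=> pp p3; rewrite /eis_num.
have p0 := prime_gt0 pp.
have dv z : z \in eis (p * M) -> (p%:Z %| z.1)%Z && (p%:Z %| z.2)%Z.
  by rewrite mem_eis => /andP[/eqP e _]; apply: inert_dvd; rewrite // e PoszM dvdz_mulr.
case: ifP => pM; last first.
  rewrite big_seq big1 // => z zM; have /andP[/dvdzP[x xE] /dvdzP[y yE]] := dv z zM.
  move: zM; rewrite mem_eis /enorm xE yE => /andP[/eqP e _].
  have e' : p%:Z * (p%:Z * (x ^+ 2 - x * y + y ^+ 2)) = p%:Z * M%:Z by rewrite -PoszM -e; ring.
  have p0' : p%:Z != 0 by lia.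
  have : (p%:Z %| M%:Z)%Z by rewrite -(mulfI p0' e') dvdz_mulr.
  by rewrite dvdzE /= pM.
rewrite -/(eis_num (M %/ p)) -(eis_scale (- p%:Z)); last by lia.
rewrite abszN absz_nat -mulnn -mulnA (mulnC p (M %/ p)%N) divnK // big_seq [RHS]big_seq_cond.
apply: eq_bigl => z; case: (boolP (z \in eis _)) => //= /dv.
by rewrite !dvdzE abszN.
Qed.

(** With k = (p - 1) / 3, at most k of the p - 1 nonzero x satisfy x^k = 1. Any other x gives a
    primitive cube root of unity x^k, whose opposite is the root sought. *)
Lemma cube_root_Fp (p : nat) : prime p -> (p %% 3 = 1)%N -> exists c : 'F_p, c ^+ 2 - c + 1 = 0.
Proof.
move=> pp p3.
have p1 := prime_gt1 pp.
pose k := (p %/ 3)%N.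
have k0 : (0 < k)%N by rewrite /k; case: (p) p1 p3 => [|[|[|q]]] // _ _; lia.
have pE : p = (k * 3).+1 by rewrite /k; lia.
have [x x0 xk] : exists2 x : 'F_p, x != 0 & x ^+ k != 1.
  apply/exists_inP; apply: contraT; rewrite negb_exists_in => /forall_inP H.
  have := @max_unity_roots _ k (enum [pred x : 'F_p | x != 0]) k0 _ (enum_uniq _).
  rewrite -cardE cardC1 card_Fp // => h.
  suff : (p.-1 <= k)%N by lia.
  apply: h; apply/allP => x; rewrite mem_enum inE => x0.
  by rewrite unity_rootE; have := H x x0; rewrite negbK.
have x3 : (x ^+ k) ^+ 3 = 1.
  by rewrite -exprM; apply: (mulfI x0); rewrite -exprS -pE Fp_frobenius // mulr1.
exists (- x ^+ k); apply/eqP; move: x3 xk; set w := x ^+ k => w3 w1.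
have : (w - 1) * ((- w) ^+ 2 - - w + 1) = 0.
  by transitivity (w ^+ 3 - 1); [ring | rewrite w3 subrr].
by move/eqP; rewrite mulf_eq0 subr_eq0 (negbTE w1).
Qed.

Lemma nat_sqrt n : exists r, (r * r <= n < r.+1 * r.+1)%N.
Proof.
elim: n => [|n [r /andP[h1 h2]]]; first by exists 0%N.
have [h|h] := ltnP n.+1 (r.+1 * r.+1)%N; first by exists r; apply/andP; split; lia.
by exists r.+1; apply/andP; split; nia.
Qed.

(** Pigeonhole: for r the integer square root of p, the (r + 1)^2 > p values i - c j with i, j at
    most r cannot be distinct modulo p. A collision gives z as a difference of index pairs; r^2 < p
    is strict since a prime is not a square. *)
Lemma thue (p : nat) (c : 'F_p) : prime p ->
  exists z : int * int, [/\ z != (0, 0), (`|z.1| ^ 2 < p)%N, (`|z.2| ^ 2 < p)%N &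
    z.1%:~R = c * z.2%:~R].
Proof.
move=> pp; have p1 := prime_gt1 pp.
have [r /andP[r1 r2]] := nat_sqrt p.
have rp : (r * r < p)%N.
  rewrite ltn_neqAle r1 andbT; apply/eqP => e.
  have : (r %| p)%N by rewrite -e dvdn_mulr.
  by move/primeP: pp => [_ h] /h /orP[/eqP ?|/eqP ?]; subst r; nia.
pose f (ij : 'I_r.+1 * 'I_r.+1) : 'F_p := (ij.1%:R - c * ij.2%:R).
have : ~~ injectiveb f.
  apply/negP => /injectiveP /leq_card.
  by rewrite card_prod card_ord card_Fp // leqNgt r2.
move=> /injectivePn[[i j] [[i' j'] ne]] /eqP.
rewrite /f /= -subr_eq0 => /eqP e.
have bnd (k l : 'I_r.+1) : (`|k%:Z - l%:Z| ^ 2 < p)%N.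
  have hk := ltn_ord k; have hl := ltn_ord l.
  have : (`|k%:Z - l%:Z| <= r)%N by lia.
  by set t := absz _ => tr; rewrite -mulnn; apply: leq_ltn_trans rp; apply: leq_mul.
exists (i%:Z - i'%:Z, j%:Z - j'%:Z); split; rewrite ?bnd //=.
  apply: contraNneq ne => -[ei ej]; apply/eqP; congr (_, _); apply: val_inj => /=; lia.
apply/eqP; rewrite -subr_eq0 !rmorphB /= -!pmulrn; apply/eqP; rewrite -[RHS]e.
by ring.
Qed.

(** Thue's lemma for a root c of c^2 - c + 1 gives a nonzero vector whose norm is a multiple of p
    below 3p, hence p or 2p. *)
Lemma split_prime_norm (p : nat) : prime p -> (p %% 3 = 1)%N ->
  exists2 u, enorm u = p%:Z & eprim u.
Proof.
move=> pp p3.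
have [c c0] := cube_root_Fp p pp p3.
have p1 := prime_gt1 pp.
have [[x y] [z0 /= bx by_ xy]] := thue p c pp.
have [k kE] : exists k, enorm (x, y) = k * p%:Z.
  apply/dvdzP; rewrite -intr_Fp_eq0 // /enorm /= rmorphD rmorphB !rmorphXn rmorphM /= xy.
  apply/eqP; transitivity ((c ^+ 2 - c + 1) * (y%:~R) ^+ 2); first by ring.
  by rewrite c0 mul0r.
have nE : enorm (x, y) * 4 = (2 * x - y) ^+ 2 + 3 * y ^+ 2 by rewrite /enorm /=; ring.
have nE' : enorm (x, y) * 4 = (2 * y - x) ^+ 2 + 3 * x ^+ 2 by rewrite /enorm /=; ring.
have bx' : x ^+ 2 < p%:Z by rewrite -(ger0_norm (sqr_ge0 x)) -abszE abszX ltz_nat.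
have by' : y ^+ 2 < p%:Z by rewrite -(ger0_norm (sqr_ge0 y)) -abszE abszX ltz_nat.
have npos : 0 < enorm (x, y).
  have := sqr_ge0 (2 * x - y); have := sqr_ge0 (2 * y - x).
  have : (0 < x ^+ 2) || (0 < y ^+ 2).
    by rewrite !exprn_even_gt0 //=; move: z0; rewrite xpair_eqE negb_and.
  by move: (sqr_ge0 x) (sqr_ge0 y) nE nE'; clear; lia.
have nlt : enorm (x, y) < 3 * p%:Z.
  have : enorm (x, y) * 2 = 3 * (x ^+ 2 + y ^+ 2) - (x + y) ^+ 2 by rewrite /enorm /=; ring.
  by move: (sqr_ge0 (x + y)) bx' by'; clear; lia.
have p0 : 0 < p%:Z by rewrite ltz_nat prime_gt0.
have k12 : k = 1 \/ k = 2.
  by move: npos nlt; rewrite kE pmulr_lgt0 // ltr_pM2r // => k1 k2; clear -k1 k2; lia.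
(* An even norm forces both coordinates to be even, so it is divisible by 4, whereas 2p is not. *)
have {k12} k1 : k = 1.
  case: k12 => // k2; exfalso; rewrite k2 in kE.
  have podd : p%:Z = 2 * (p %/ 2)%:Z + 1.
    by have [p2|] := even_prime pp; [rewrite p2 in p3 | clear; lia].
  pose a := (x %/ 2)%Z; pose b := (y %/ 2)%Z.
  have hx : x = 2 * a \/ x = 2 * a + 1 by clear; rewrite /a; lia.
  have hy : y = 2 * b \/ y = 2 * b + 1 by clear; rewrite /b; lia.
  have odd_ne t : enorm (x, y) = 2 * t + 1 -> False.
    by rewrite kE => h; clear -h; lia.
  case: hx => hx; case: hy => hy.
  - have : enorm (x, y) = 4 * (a ^+ 2 - a * b + b ^+ 2) by rewrite /enorm /= hx hy; ring.
    by rewrite kE podd => h; clear -h; lia.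
  - by apply: (odd_ne (2 * a ^+ 2 - 2 * a * b - a + 2 * b ^+ 2 + 2 * b));
    rewrite /enorm /= hx hy; ring.
  - by apply: (odd_ne (2 * a ^+ 2 + 2 * a - 2 * a * b - b + 2 * b ^+ 2));
    rewrite /enorm /= hx hy; ring.
  - by apply: (odd_ne (2 * a ^+ 2 + a - 2 * a * b + b + 2 * b ^+ 2)); rewrite /enorm /= hx hy;
    ring.
rewrite k1 mul1r in kE.
(* The square of x + y is the norm plus 3 x y, hence 1 mod 3; so (x, y) or its opposite satisfies
   [eprim]. *)
have s3 : exists t, x + y = 3 * t + 1 \/ x + y = 3 * t - 1.
  have : (x + y) ^+ 2 = 3 * (x * y + (p %/ 3)%:Z) + 1.
    have -> : (x + y) ^+ 2 = enorm (x, y) + 3 * (x * y) by rewrite /enorm /=; ring.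
    by rewrite kE; clear -p3; lia.
  pose t := ((x + y) %/ 3)%Z.
  have : x + y = 3 * t \/ x + y = 3 * t + 1 \/ x + y = 3 * (t + 1) - 1 by clear; rewrite /t; lia.
  case=> [->|[h|h]] sq; [ | by exists t; left | by exists (t + 1); right].
  have : 3 * (3 * t ^+ 2) = 3 * (x * y + (p %/ 3)%:Z) + 1 by rewrite -sq; ring.
  by move=> F; clear -F; lia.
case: s3 => t [h|h].
  by exists (x, y) => //; rewrite /eprim /= h addrK dvdz_mulr.
exists (- x, - y); first by rewrite -kE /enorm /=; ring.
rewrite /eprim /= (_ : _ - 1 = 3 * (- t)) ?dvdz_mulr //.
by rewrite -opprD h; ring.
Qed.

(** The recursion with characteristic roots 1 and c; [eis_split] and [eis_inert] are its cases c = 1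
    and c = -1. *)
Lemma chi_pow_sum_rec (R : comPzRingType) (c : R) k :
  \sum_(i < k.+3) c ^+ i = (1 + c) * (\sum_(i < k.+2) c ^+ i) - c * (\sum_(i < k.+1) c ^+ i).
Proof.
rewrite -!(big_mkord xpredT (fun i => c ^+ i)).
rewrite [\sum_(0 <= i < k.+3) _]big_nat_recr //= [\sum_(0 <= i < k.+2) _]big_nat_recr //=.
by rewrite !exprS; ring.
Qed.

Lemma eis_pfactor (p : nat) k m : prime p -> p != 3 -> (0 < m)%N -> ~~ (p %| m)%N ->
  eis_num (p ^ k * m) = (\sum_(i < k.+1) chi p ^+ i) * eis_num m.
Proof.
move=> pp p3 m0 pm.
have p0 := prime_gt0 pp.
have rec M : eis_num (p * M) = (1 + chi p) * eis_num M -
    chi p * (if (p %| M)%N then eis_num (M %/ p)%N else 0).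
  case: (mod3P p) => e.
  - by move: p3; rewrite eq_sym -(dvdn_prime2 (isT : prime 3)) // /dvdn e.
  - have [u up u3] := split_prime_norm p pp e.
    by rewrite (eis_split p u) // /chi e /= subr0 mul1r.
  - by rewrite eis_inert // /chi e /= sub0r subrr mul0r sub0r mulN1r opprK.
(* The recursion has two terms, so the induction carries two consecutive exponents. *)
suff : eis_num (p ^ k * m) = (\sum_(i < k.+1) chi p ^+ i) * eis_num m /\
       eis_num (p ^ k.+1 * m) = (\sum_(i < k.+2) chi p ^+ i) * eis_num m by case.
elim: k => [|k [IH1 IH2]].
  split; first by rewrite mul1n big_ord1 expr0 mul1r.
  by rewrite expn1 rec (negbTE pm) mulr0 subr0 big_ord_recr big_ord1 expr0 expr1.
split=> //.
rewrite expnS -mulnA rec expnS -mulnA dvdn_mulr // mulKn // mulnA -expnS IH1 IH2.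
by rewrite chi_pow_sum_rec; ring.
Qed.

Lemma eis_num_chi_sum M : (0 < M)%N -> ~~ (3 %| M)%N -> eis_num M = 3 * chi_sum M.
Proof.
elim/ltn_ind: M => M IH M0 M3.
have [M1|M1] := leqP M 1.
  have -> : M = 1%N by lia.
  by rewrite eis_num1 /chi_sum big_seq1.
have pp := pdiv_prime M1; set p := pdiv M in pp.
have [m pm ME] := pfactor_coprime pp M0.
have pM : (p %| M)%N by exact: pdiv_dvd.
have m0 : (0 < m)%N by case: m ME {pm} => // ME; rewrite ME in M0.
have k0 : (0 < logn p M)%N by rewrite logn_gt0 mem_primes pp M0.
rewrite prime_coprime // in pm.
rewrite mulnC in ME.
have p3 : p != 3 by apply: contraNneq M3 => p3; move: pM; rewrite p3.
rewrite ME eis_pfactor // chi_sum_pfactor //.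
rewrite IH //; first by rewrite mulrCA.
  rewrite ME -{1}[m]mul1n ltn_pmul2r //.
  by rewrite -(expn0 p) ltn_exp2l ?prime_gt1.
by apply: contra M3; rewrite ME => h; apply: dvdn_mull.
Qed.

(** * 3-cores *)

Fixpoint doubled (k : nat) : seq nat :=
  if k is k'.+1 then [:: k, k & doubled k'] else [::].

(** The shape of a 3-core, for m equal to 1 or 2: [w] rows falling by 2 down to k + m, then the rows
    k, k, .., 1, 1. *)
Fixpoint stair (k m w : nat) : seq nat :=
  if w is w'.+1 then (k + m + 2 * w')%N :: stair k m w' else doubled k.

Definition is_3core (s : seq nat) := is_partition s && is_core 3 s.

(** The hook lengths in a row of length [a] placed on top of [s]: the leg in column j is the whole
    column j of [s]. *)
Definition row_ok (a : nat) (s : seq nat) :=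
  all (fun j => ~~ (3 %| a - j + conj_part s j)%N) (iota 0 a).

Lemma conj_part_cons a s j : conj_part (a :: s) j = ((j < a) + conj_part s j)%N.
Proof. by []. Qed.

Lemma is_partition_cons a s :
  is_partition (a :: s) = [&& (0 < a)%N, all (geq a) s & is_partition s].
Proof.
rewrite /is_partition /= path_sortedE; last by move=> x y z /= h1 h2; apply: leq_trans h2 h1.
by case: (0 < a)%N; case: (all (geq a) s); rewrite ?andbF ?andbT.
Qed.

(** A hook only involves its own row and the rows below, so a new top row leaves the old hooks
    unchanged; 3-cores can thus be built from the bottom row up. *)
Lemma is_3core_cons a s : is_3core (a :: s) =
  [&& (0 < a)%N, all (geq a) s, is_3core s & row_ok a s].
Proof.
rewrite /is_3core is_partition_cons; case: (0 < a)%N => //=.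
case: (boolP (all (geq a) s)) => //= /allP as_.
rewrite -andbA; congr (_ && _); rewrite /is_core /= andbC; congr (_ && _).
  rewrite (iotaDl 1 0) all_map; apply: eq_in_all => i; rewrite mem_iota /= => i_s.
  rewrite add0n; apply: eq_in_all => j; rewrite mem_iota add0n /= => ji.
  rewrite /hook conj_part_cons.
  have -> : (j < a)%N by apply: leq_trans ji (as_ _ _); apply: mem_nth.
  by rewrite add1n subSS.
rewrite /row_ok; apply: eq_in_all => j; rewrite mem_iota add0n /= => ja.
by rewrite /hook conj_part_cons ja /=; congr (~~ (_ %| _)%N); lia.
Qed.

Lemma conj_doubled k j : conj_part (doubled k) j = (2 * (k - j))%N.
Proof. by elim: k => // k IH; rewrite [doubled _]/= !conj_part_cons IH; lia. Qed.

Lemma conj_stair k m w j : conj_part (stair k m w) j =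
  (2 * (k - j) + (if j < k + m then w else w - ((j - (k + m)) %/ 2).+1))%N.
Proof.
elim: w => [|w IH]; first by rewrite [stair _ _ _]/= conj_doubled; case: ifP; lia.
by rewrite [stair _ _ _]/= conj_part_cons IH; case: ifP; lia.
Qed.

Lemma stair_le k m w x : x \in stair k m w -> (x <= k + m + 2 * w)%N.
Proof.
elim: w => [|w IH] /=.
  elim: k x => // k IH x; rewrite /= !inE => /or3P[/eqP->|/eqP->|/IH]; lia.
by rewrite inE => /orP[/eqP->|/IH]; lia.
Qed.

Lemma is_3core_stairS k m w : (m == 1)%N || (m == 2)%N ->
  is_3core (stair k m w) -> is_3core (stair k m w.+1).
Proof.
move=> m12 gs; rewrite [stair _ _ _]/= is_3core_cons gs /=; apply/and3P; split.
- lia.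
- by apply/allP => x /stair_le.
- apply/allP => j; rewrite mem_iota conj_stair => jb.
  by case: ifP; lia.
Qed.

Lemma is_3core_stair k m w : (m == 1)%N || (m == 2)%N -> is_3core (stair k m w).
Proof.
move=> m12; elim: w => [|w IH]; last exact: is_3core_stairS.
elim: k => // k IH; rewrite /=.
have g1 : is_3core (stair k 1 1) by apply: is_3core_stairS.
(* The lower of the two equal rows makes a staircase with m = w = 1, so only the upper row has to be
   checked. *)
have -> : k.+1 :: k.+1 :: doubled k = k.+1 :: stair k 1 1 by rewrite /= muln0 addn0 addn1.
rewrite is_3core_cons g1 andTb; apply/and3P; split => //.
  rewrite /= andbC; apply/andP; split; last by lia.
  by apply/allP => x xk; have := stair_le k 0 0 x xk; rewrite /=; lia.
apply/allP => j; rewrite mem_iota conj_stair => jb.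
by case: ifP; lia.
Qed.

(** Induction on the rows: given a staircase, the hooks in a few columns leave at most two lengths
    for the next row, and each again gives a staircase. *)
Lemma is_3core_stairP s : is_3core s -> exists k m w, (m == 1)%N || (m == 2)%N /\ s = stair k m w.
Proof.
elim: s => [|a s IH]; first by exists 0%N, 1%N, 0%N.
rewrite is_3core_cons => /and4P[a0 /allP as_ gs /allP ra].
have [k [m [w [m12 sE]]]] := IH gs; subst s.
have row j : (j < a)%N -> ~~ (3 %| a - j + conj_part (stair k m w) j)%N.
  by move=> ja; apply: ra; rewrite mem_iota.
have a3 := row (a - 3)%N; have a2 := row (a - 2)%N; have a1 := row (a - 1)%N; have r0 := row 0%N.
case: w {IH gs ra row} as_ a3 a2 a1 r0 => [|w] as_; rewrite !conj_stair => a3 a2 a1 r0.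
  have ka : (k <= a)%N by case: k as_ {a3 a2 a1 r0} => // k as_; apply: as_; rewrite /= inE eqxx.
  have h3 : (a < k + 3)%N by move: a3; case: ifP => _ a3; clear -a3; lia.
  have h0 : a != k by move: r0; case: ifP => _ r0; clear -r0 a0; lia.
  have : a = (k + 1)%N \/ a = (k + 2)%N by clear -ka h3 h0; lia.
  by case=> ->; [exists k, 1%N, 1%N | exists k, 2%N, 1%N]; rewrite /= muln0 addn0.
have ka : (k + m + 2 * w <= a)%N by apply: as_; rewrite /= inE eqxx.
(* Let h be the current top row. A row a > h + 2 has a hook of length 3 in column a - 3, and a = h +
   1 has one in column a - 2. So does a = h, except over a single row k + 1, which then becomes a
   doubled row. *)
have : a = (k + m + 2 * w.+1)%N \/ [/\ w = 0%N, m = 1%N & a = k.+1].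
  set h := (k + m + 2 * w)%N in ka.
  have h3 : (a < h + 3)%N by move: a3; case: ifP => + a3; clear -a3 ka m12; lia.
  have h1 : a != h.+1 by move: a2; case: ifP => + a2; clear -a2 ka m12; lia.
  have h0 : (w == 0%N) && (m == 1%N) || (a != h) by move: a2; case: ifP => + a2;
    clear -a2 ka m12; lia.
  case/orP: h0 => [/andP[/eqP w0 /eqP m1]|h0]; last by left; rewrite /h in h0 h1 h3 ka;
    clear -h0 h1 h3 ka; lia.
  have [ah|ah] := eqVneq a h; [right | left]; rewrite /h in ah h1 h3 ka;
    last by clear -ah h1 h3 ka; lia.
  by split => //; rewrite ah w0 m1; clear; lia.
case=> [->|[-> -> ->]]; first by exists k, m, w.+2.
by exists k.+1, 1%N, 0%N; rewrite /= muln0 addn0 addn1.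
Qed.

(* The 3-core whose first-column hook lengths are [1, 4, .., 3u - 2] and [2, 5, .., 3v - 1]. *)
Definition core_of (uv : nat * nat) : seq nat :=
  if (uv.2 <= uv.1)%N then stair uv.2 1 (uv.1 - uv.2) else stair uv.1 2 (uv.2 - uv.1).

Lemma is_3core_core_of uv : is_3core (core_of uv).
Proof. by rewrite /core_of; case: ifP => _; apply: is_3core_stair. Qed.

Lemma is_3coreP s : is_3core s -> exists uv, s = core_of uv.
Proof.
move=> /is_3core_stairP[k [m [w [/orP[/eqP->|/eqP->] ->]]]].
  by exists (k + w, k)%N; rewrite /core_of /= leq_addr addKn.
case: w => [|w]; first by exists (k, k); rewrite /core_of /= leqnn subnn.
exists (k, k + w.+1)%N; rewrite /core_of /= (_ : (k + w.+1 <= k)%N = false) ?addKn //; lia.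
Qed.

Lemma size_stair k m w : size (stair k m w) = (w + 2 * k)%N.
Proof.
elim: w => [|w IH] /=; last by rewrite IH.
by elim: k => //= k ->; lia.
Qed.

Lemma psize_stair k m w : (psize (stair k m w) + w = w * (k + m) + w * w + k * k.+1)%N.
Proof.
rewrite /psize; elim: w => [|w IH] /=; last by nia.
by elim: k => //= k IH; nia.
Qed.

Lemma size_core_of u v : size (core_of (u, v)) = (u + v)%N.
Proof. by rewrite /core_of /=; case: ifP => uv; rewrite size_stair; lia. Qed.

Lemma psize_core_of u v : (psize (core_of (u, v)) + u * v = u * u + v * v + v)%N.
Proof.
rewrite /core_of /=; case: leqP => uv.
  have := psize_stair v 1 (u - v); move: (u - v)%N (subnKC uv) => w <-; nia.
have := psize_stair u 2 (v - u); move: (v - u)%N (subnKC (ltnW uv)) => w <-; nia.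
Qed.

(* The length u + v and the size determine 3v^2 - (3(u+v) - 1)v; two distinct such v
   would have sum (u+v) - 1/3. *)
Lemma core_of_inj : injective core_of.
Proof.
move=> [u v] [u' v'] e.
have := size_core_of u v; have := psize_core_of u v; rewrite e.
have := psize_core_of u' v'; rewrite size_core_of.
move: (psize _) => N e1 e2 e3.
have uE : u' = (u + v - v')%N by lia.
have : (v%:Z - v'%:Z) * (3 * (v%:Z + v'%:Z) - 3 * (u%:Z + v%:Z) + 1) = 0.
  have f : u'%:Z = u%:Z + v%:Z - v'%:Z by lia.
  have e1' : N%:Z + u'%:Z * v'%:Z = u'%:Z * u'%:Z + v'%:Z * v'%:Z + v'%:Z by lia.
  have e2' : N%:Z + u%:Z * v%:Z = u%:Z * u%:Z + v%:Z * v%:Z + v%:Z by lia.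
  rewrite f in e1'.
  transitivity (N%:Z - N%:Z); last by rewrite subrr.
  have -> : N%:Z = u%:Z * u%:Z + v%:Z * v%:Z + v%:Z - u%:Z * v%:Z by lia.
  have g : N%:Z = (u%:Z + v%:Z - v'%:Z) * (u%:Z + v%:Z - v'%:Z) + v'%:Z * v'%:Z +
    v'%:Z - (u%:Z + v%:Z - v'%:Z) * v'%:Z by lia.
  have -> : u%:Z * u%:Z + v%:Z * v%:Z + v%:Z - u%:Z * v%:Z = N%:Z by lia.
  by rewrite {1}g; lia.
move/eqP; rewrite mulf_eq0 => /orP[/eqP h|/eqP h]; last by clear -h; lia.
by congr (_, _); clear -h e3; lia.
Qed.

(** * Enumeration of 3-cores and their match with Eisenstein integers *)

Lemma mem_seqs_len k A s : (s \in seqs_len k A) = (size s == k) && all (mem A) s.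
Proof.
elim: k s => [|k IH] s /=; first by rewrite inE; case: s.
apply/allpairsP/andP => [[[a t] /= [aA]]|].
  by rewrite IH => /andP[/eqP <- tA] ->; rewrite /= eqxx aA.
case: s => [|a s] [] //= sk /andP[aA sA]; exists (a, s); split => //=.
by rewrite IH sA andbT.
Qed.

Lemma uniq_seqs_len k A : uniq A -> uniq (seqs_len k A).
Proof.
move=> uA; elim: k => // k IH; apply: allpairs_uniq => //.
by move=> [? ?] [? ?] _ _ /= [-> ->].
Qed.

Lemma uniq_cands n : uniq (cands n).
Proof.
have -> : cands n = [seq s | k <- iota 0 n.+1, s <- seqs_len k (iota 1 n)].
  by rewrite /cands; congr flatten; apply: eq_map => k; rewrite map_id.
apply: allpairs_uniq_dep; first exact: iota_uniq.
  by move=> k _; apply: uniq_seqs_len; exact: iota_uniq.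
move=> z z' /allpairsPdep[k [s [_ sk ->]]] /allpairsPdep[k' [s' [_ sk' ->]]] /= e; subst s'.
by move: sk sk'; rewrite !mem_seqs_len => /andP[/eqP <- _] /andP[/eqP <- _].
Qed.

Lemma mem_cands n s :
  (s \in cands n) = (size s <= n)%N && all (fun x => 0 < x <= n)%N s.
Proof.
rewrite -(@eq_all _ (mem (iota 1 n))); last first.
  by move=> x; rewrite -[LHS]/(x \in iota 1 n) mem_iota; lia.
apply/flatten_mapP/andP => [[k]|[sn sA]].
  by rewrite mem_iota mem_seqs_len => kn /andP[/eqP -> ->].
by exists (size s); rewrite ?mem_iota ?mem_seqs_len ?eqxx.
Qed.

Lemma mem_cores3 n s : (psize s <= n)%N -> (s \in cores3_upto n) = is_3core s.
Proof.
move=> sn; rewrite mem_filter -/(is_3core s) andb_idr // => /andP[/andP[_ s0] _].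
have [h1 h2] : (size s <= psize s)%N /\ all (fun x => 0 < x <= psize s)%N s.
  elim: s s0 {sn} => // a s IH /= /andP[a0 /IH[h1 /allP h2]]; rewrite /psize /= in h1 h2 *.
  split; first by lia.
  apply/andP; split; first by lia.
  by apply/allP => x /h2; lia.
rewrite mem_cands (leq_trans h1 sn) /=.
by apply: sub_all h2 => x; lia.
Qed.

(** At x = 2u - v, y = u + v + 1 the two linear forms are 3u + 1 and 3v + 2; for elements satisfying
    [eprim], their positivity means that u and v are natural numbers. *)
Definition sector (z : int * int) : bool := (0 < z.1 + z.2) && (0 < 2 * z.2 - z.1).

(* Multiplication by [w] permutes three sectors. *)
Lemma eis_num_sector M : eis_num M = 3 * \sum_(z <- eis M | sector z) 1.
Proof.
pose rot (z : int * int) := (- z.2, z.1 - z.2).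
have rotE (P : pred (int * int)) :
    \sum_(z <- eis M | P z) 1 = \sum_(z <- eis M | P (rot z)) 1 :> int.
  apply: (@big_seq_bij _ _ _ _ _ (fun z => P (rot z)) _ rot); rewrite ?uniq_eis //.
  - move=> z; rewrite !mem_eis => /andP[/eqP <- z3] ->; rewrite andbT.
    apply/andP; split; first by apply/eqP; rewrite /enorm /=; ring.
    by move: z3; rewrite /eprim /=; lia.
  - by move=> [x y] [x' y'] _ _ _ _ /= [e1 e2]; congr (_, _); lia.
  - move=> [x y]; rewrite mem_eis => /andP[/eqP e z3] Pz; exists (y - x, - x); last first.
      by rewrite /rot /=; congr (_, _); ring.
    rewrite mem_eis; apply/andP; split; last first.
      by move: Pz; congr (P _); rewrite /rot /=; congr (_, _); ring.
    apply/andP; split; first by apply/eqP; rewrite -e /enorm /=; ring.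
    by move: z3; rewrite /eprim /=; lia.
have -> : eis_num M = \sum_(z <- eis M | sector z) 1 + \sum_(z <- eis M | sector (rot z)) 1 +
    \sum_(z <- eis M | sector (rot (rot z))) 1.
  rewrite [X in X + _ + _]big_mkcond [X in _ + X + _]big_mkcond [X in _ + X]big_mkcond.
  rewrite -!big_split /eis_num big_seq [RHS]big_seq; apply: eq_bigr => -[x y].
  rewrite mem_eis /sector /eprim /= => /andP[_ z3].
  by do !case: ifP => ?; lia.
by rewrite -(rotE (fun z => sector (rot z))) -(rotE sector); ring.
Qed.

(** The core of (u, v) corresponds to (2u - v) + (u + v + 1) w, whose norm is three times the size
    of the core plus 1. *)
Lemma cores3_count n k : (k <= n)%N ->
  \sum_(s <- cores3_upto n | psize s == k) 1 = chi_sum (3 * k + 1).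
Proof.
move=> kn; set M := (3 * k + 1)%N.
have : eis_num M = 3 * chi_sum M by rewrite eis_num_chi_sum // /M; lia.
rewrite eis_num_sector.
suff -> : \sum_(s <- cores3_upto n | psize s == k) 1 = \sum_(z <- eis M | sector z) 1 :> int.
  by move/mulfI => ->.
pose uv (z : int * int) := (absz ((z.1 + z.2 - 1) %/ 3)%Z, absz ((2 * z.2 - z.1 - 2) %/ 3)%Z).
have uvP x y : eprim (x, y) -> sector (x, y) ->
    x = 2 * (uv (x, y)).1%:Z - (uv (x, y)).2%:Z /\ y = (uv (x, y)).1%:Z + (uv (x, y)).2%:Z + 1.
  by rewrite /eprim /sector /uv /=; lia.
have szE u v : psize (core_of (u, v)) = k <-> enorm (2 * u%:Z - v%:Z, u%:Z + v%:Z + 1) = M%:Z.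
  have := psize_core_of u v; rewrite /M /enorm /=; move: (psize _) => N e.
  have e' : N%:Z + u%:Z * v%:Z = u%:Z * u%:Z + v%:Z * v%:Z + v%:Z by lia.
  have -> : (2 * u%:Z - v%:Z) ^+ 2 - (2 * u%:Z - v%:Z) * (u%:Z + v%:Z + 1) + (u%:Z + v%:Z +
    1) ^+ 2 = 3 * N%:Z + 1.
    have -> : N%:Z = u%:Z * u%:Z + v%:Z * v%:Z + v%:Z - u%:Z * v%:Z by rewrite -e' addrK.
    by ring.
  clear; lia.
apply: (@big_seq_bij _ _ _ _ _ sector _ (fun z => core_of (uv z))).
- exact: uniq_eis.
- exact: filter_uniq (uniq_cands n).
- move=> [x y]; rewrite mem_eis => /andP[/eqP zM z3] zs.
  have [xE yE] := uvP x y z3 zs; case: (uv (x, y)) xE yE => u v /= xE yE.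
  have sk : psize (core_of (u, v)) = k by apply/szE; rewrite -xE -yE.
  by rewrite mem_cores3 sk // is_3core_core_of eqxx.
- move=> [x y] [x' y']; rewrite !mem_eis => /andP[_ z3] /andP[_ z3'] zs zs' /core_of_inj e.
  have [hx hy] := uvP x y z3 zs; have [hx' hy'] := uvP x' y' z3' zs'.
  rewrite e in hx hy.
  by congr (_, _); [exact: etrans hx (esym hx') | exact: etrans hy (esym hy')].
- move=> s + /eqP sk; rewrite mem_cores3 ?sk // => /is_3coreP[[u v] sE]; subst s.
  have zE : uv (2 * u%:Z - v%:Z, u%:Z + v%:Z + 1) = (u, v).
    by rewrite /uv /=; congr (_, _); lia.
  exists (2 * u%:Z - v%:Z, u%:Z + v%:Z + 1); last by rewrite zE.
  rewrite mem_eis; move/szE: sk => ->; rewrite eqxx /eprim /sector /=.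
  by lia.
Qed.

(** * The number of triples of 3-cores *)

Lemma sum_1mod3 m (F : nat -> int) :
  (forall k, (0 < k < 3 * m + 2)%N -> (k %% 3 != 1)%N -> F k = 0) ->
  \sum_(1 <= k < 3 * m + 2) F k = \sum_(0 <= j < m.+1) F (3 * j + 1)%N.
Proof.
elim: m => [|m IH] F0; first by rewrite !big_nat1.
have -> : (3 * m.+1 + 2 = (3 * m + 2).+3)%N by lia.
rewrite [RHS]big_nat_recr //= -IH; last by move=> k ? ?; apply: F0 => //; lia.
rewrite 3?big_nat_recr //=; last by lia.
rewrite (F0 (3 * m + 2)%N) ?(F0 (3 * m + 2).+1) ?addr0; try lia.
by congr (_ + F _); lia.
Qed.

(** [cores3_upto n] bounds the length and the entries but not the size, so it may list 3-cores
    larger than n; the vanishing of [f] discards them. *)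
Lemma sum_cores3 n (f : nat -> int) : (forall k, (n < k)%N -> f k = 0) ->
  \sum_(s <- cores3_upto n) f (psize s) = \sum_(0 <= k < n.+1) chi_sum (3 * k + 1) * f k.
Proof.
move=> f0.
rewrite [RHS]big_nat_cond.
under [RHS]eq_bigr => k /andP[/andP[_ kn] _] do rewrite -(cores3_count n k kn) mulr_suml big_mkcond.
rewrite -[RHS]big_nat_cond exchange_big /=; apply: eq_bigr => s _.
rewrite -big_mkcond /=.
have [sn|ns] := leqP (psize s) n.
  rewrite (eq_bigl (pred1 (psize s))) => [|k]; last exact: eq_sym.
  by rewrite -big_filter filter_pred1_uniq ?iota_uniq ?mem_index_iota // big_seq1 mul1r.
by rewrite [LHS]f0 // big1 // => k /eqP <-; rewrite f0 // mulr0.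
Qed.

Lemma B3_conv n : (B3 n)%:Z = \sum_(0 <= i < n.+1) chi_sum (3 * i + 1) *
   \sum_(0 <= j < (n - i).+1) chi_sum (3 * j + 1) * chi_sum (3 * (n - i - j) + 1).
Proof.
pose e k := chi_sum (3 * k + 1).
(* [g i] counts the third cores that complete a total of i to n. The value 0 beyond n is the
   vanishing that [sum_cores3] asks for; [h] below is cut off for the same reason. *)
pose g k := if (k <= n)%N then e (n - k)%N else 0.
have g1 i : \sum_(s <- cores3_upto n) (i + psize s == n)%N%:R = g i.
  rewrite (sum_cores3 n (fun k => (i + k == n)%N%:R)); last by move=> k nk; rewrite gtn_eqF //;
    lia.
  rewrite /g; case: leqP => ni.
    rewrite (bigD1_seq (n - i)%N) ?iota_uniq ?mem_index_iota //=; last by lia.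
    rewrite subnKC // eqxx mulr1 big1 ?addr0 // => k ki.
    by rewrite (_ : (i + k == n)%N = false) ?mulr0 //; lia.
  by rewrite big1 // => k _; rewrite (_ : (i + k == n)%N = false) ?mulr0 //; lia.
have g2 i : (i <= n)%N -> \sum_(s <- cores3_upto n) g (i + psize s)%N =
    \sum_(0 <= j < (n - i).+1) e j * e (n - i - j)%N.
  move=> ni; rewrite (sum_cores3 n (fun k => g (i + k)%N)); last first.
    by move=> k nk; rewrite /g leqNgt (leq_trans nk) // leq_addl.
  rewrite (@big_cat_nat _ _ _ (n - i).+1) //=; last by rewrite ltnS leq_subr.
  rewrite [X in _ + X]big_nat_cond [X in _ + X]big1 ?addr0.
    rewrite big_nat [RHS]big_nat; apply: eq_bigr => j /andP[_ jn].
    by rewrite /g (_ : (i + j <= n)%N) ?subnDA //; lia.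
  by move=> j /andP[/andP[jn _] _]; rewrite /g (_ : (i + j <= n)%N = false) ?mulr0 //; lia.
pose h k := if (k <= n)%N then \sum_(0 <= j < (n - k).+1) e j * e (n - k - j)%N else 0.
transitivity (\sum_(s <- cores3_upto n) h (psize s)); last first.
  rewrite sum_cores3; last by move=> k nk; rewrite /h leqNgt nk.
  by rewrite big_nat [RHS]big_nat; apply: eq_bigr => i /andP[_ ni]; rewrite /h -ltnS ni.
rewrite /B3 -sum1_count (big_morph Posz PoszD (erefl _)) big_mkcond.
rewrite big_allpairs_dep big_allpairs_dep /=.
apply: eq_bigr => a _; rewrite /h; case: leqP => an.
  rewrite -g2 //; apply: eq_bigr => b _; rewrite -g1.
  by apply: eq_bigr => c _; case: eqP.
apply: big1 => b _; apply: big1 => c _; rewrite (_ : _ == _ = false) //; lia.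
Qed.

Lemma B3_chi_sq_sum n : (B3 n)%:Z = chi_sq_sum n.+1.
Proof.
suff /mulfI -> : 3 * (B3 n)%:Z = 3 * chi_sq_sum n.+1 by [].
rewrite -chi_sigma_conv // B3_conv mulr_sumr [RHS]big_mkcond.
have -> : (3 * n.+1 = (3 * n + 2).+1)%N by lia.
rewrite [RHS]big_nat_recr /=; last by lia.
(* The range of [sum_1mod3] stops just before k = 3n + 2; this last term has E at a number 2 mod
   3. *)
rewrite [X in _ = _ + X](_ : _ = 0); last by rewrite chi_sum_2 ?mul0r ?if_same //; lia.
rewrite addr0 sum_1mod3; last first.
  move=> k kn k1; case: ifP => // k3; rewrite chi_sum_2 ?mul0r //; lia.
rewrite big_nat [RHS]big_nat; apply: eq_bigr => i /andP[_ ni].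
rewrite (_ : (3 %| 3 * i + 1)%N = false) /=; last by lia.
rewrite mulrCA; congr (_ * _).
have -> : ((3 * n + 2).+1 - (3 * i + 1) = 3 * (n - i) + 2)%N by lia.
rewrite -chi_sum_conv; last by lia.
congr (_ * _); rewrite sum_1mod3.
  rewrite big_nat [RHS]big_nat; apply: eq_bigr => j /andP[_ ji].
  by congr (_ * chi_sum _); lia.
(* For k = 0 mod 3 the complementary argument is 2 mod 3 and its factor vanishes; for k = 2 mod 3
   the factor at k does. *)
move=> k kn k1; case: (mod3P k) => k3; rewrite ?k3 // in k1.
  by rewrite (chi_sum_2 (_ - _)) ?mulr0 //; lia.
by rewrite chi_sum_2 ?mul0r.
Qed.

Theorem theorem3p2 (n : nat) :
  (B3 n)%:Z =
    \sum_(d <- divisors n.+1 | (d %% 3 == 1)%N) ((n.+1 %/ d) ^ 2)%N%:Z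
  - \sum_(d <- divisors n.+1 | (d %% 3 == 2)%N) ((n.+1 %/ d) ^ 2)%N%:Z
  /\
  (B3 n)%:R =
    (3%:R : rat) ^+ (2 * logn 3 n.+1)
  * \prod_(p <- primes n.+1 | (p %% 3 == 1)%N)
       ((p%:R ^+ (2 * (logn p n.+1).+1) - 1) / (p%:R ^+ 2 - 1))
  * \prod_(q <- primes n.+1 | (q %% 3 == 2)%N)
       ((q%:R ^+ (2 * logn q n.+1 + 2) + (-1) ^+ logn q n.+1) / (q%:R ^+ 2 + 1)).
Proof.
split; last by rewrite -chi_sq_sum_prod -B3_chi_sq_sum -pmulrn.
rewrite B3_chi_sq_sum /chi_sq_sum [X in X - _]big_mkcond [X in _ - X]big_mkcond -sumrB.
apply: eq_bigr => d _; rewrite (_ : ((n.+1 %/ d) ^ 2)%N%:Z = (n.+1 %/ d)%N%:Z ^+ 2);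
  last by rewrite expr2 -PoszM mulnn.
by rewrite /chi; case: (mod3P d) => -> /=; rewrite ?subrr ?subr0 ?sub0r ?mul0r ?mul1r ?mulN1r.
Qed.
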